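(* Let $\nu$ be a positive (not necessarily bounded) measure on $\mathbb{R}$, not concentrated on one point, with Laplace transform $L_{\nu}(\theta)=\int_{\mathbb{R}}e^{\theta x}\nu(dx)\le\infty$, and such that the interior $(\alpha,\beta)$ of the set $\{\theta\in\mathbb{R} : L_{\nu}(\theta)<\infty\}$ is not empty (here $-\infty\le\alpha<\beta\le\infty$). For $\alpha<\theta<\beta$ let $P_{\theta}$ be the probability $$P_{\theta}(dx)=e^{\theta x-\kappa_{\nu}(\theta)}\nu(dx),\qquad \kappa_{\nu}(\theta)=\log L_{\nu}(\theta),$$ and let $F(\nu)=\{P_{\theta} : \alpha<\theta<\beta\}$. Suppose that there exist a positive measure $\mu$ on $(\alpha,\beta)$ and a function $c$ on $\mathbb{R}$ such that for all $x\in\mathbb{R}$ and all $\theta\in(\alpha,\beta)$, if $X\sim P_{\theta}$, then $$\Pr(X\le x)=c(x)\int_{(\theta,\beta)}e^{ux}\,\mu(du).$$ Then, up to translation, the exponential family $F(\nu)$ is either a Gaussian family or a Gamma family.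
   Context: Gaussian family: for some fixed $\sigma>0$, the set of all probabilities $e^{-\frac{1}{2\sigma^2}(x-\theta\sigma^2)^2}\frac{dx}{\sigma\sqrt{2\pi}}$ with $\theta\in\mathbb{R}$, i.e. all normal distributions with variance $\sigma^2$. Gamma family: for some fixed shape parameter $p>0$, the set of all probabilities $e^{\theta x}(-\theta)^p x^{p-1}1_{(0,\infty)}(x)\frac{dx}{\Gamma(p)}$ with $\theta\in(-\infty,0)$. ''Up to translation'' means: there exists a real number $t$ such that $F(\nu)$ is the set of images of the members of a Gaussian family (or of a Gamma family) under the map $x\mapsto x+t$. *)

(* Defs.v *)
From mathcomp Require Import all_boot all_order all_algebra.
From mathcomp Require Import all_classical all_reals all_analysis.
Import numFieldNormedType.Exports.

Set Implicit Arguments.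
Unset Strict Implicit.
Unset Printing Implicit Defensive.

Import Order.TTheory GRing.Theory Num.Theory.

Local Open Scope classical_set_scope.
Local Open Scope ring_scope.

Section exponential_families.
Context {R : realType}.

Notation RT := (measurableTypeR R).
Implicit Types (nu : {measure set RT -> \bar R}) (F : set (probability RT R)).

Definition concentrated_on_a_point nu : Prop :=
  exists a : R, nu (~` [set a]) = 0%E.

Definition laplace nu (theta : R) : \bar R :=
  (\int[nu]_x (expR (theta * x))%:E)%E.

Definition laplace_interior nu : set R :=
  interior [set theta : R | (laplace nu theta < +oo)%E].

(* Only meaningful where 0 < laplace nu theta < +oo. *)
Definition cumulant nu (theta : R) : R := ln (fine (laplace nu theta)).

Definition tilt nu (theta : R) : set RT -> \bar R :=
  fun A => (\int[nu]_(x in A) (expR (theta * x - cumulant nu theta))%:E)%E.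

(* Laws are compared on measurable sets only: the value of a probability, as a
   Rocq function, is unconstrained on the other sets.  All the families below
   are closed under this relation, so that Leibniz equality of two of them is
   the equality of the corresponding sets of laws. *)
Definition same_law (P Q : set RT -> \bar R) : Prop :=
  forall A : set RT, measurable A -> P A = Q A.

Definition exp_family nu : set (probability RT R) :=
  [set P : probability RT R | exists2 theta : R,
     laplace_interior nu theta & same_law P (tilt nu theta)].

(* [normal_prob] takes the mean and the standard deviation. *)
Definition gaussian_family (sigma : R) : set (probability RT R) :=
  [set P : probability RT R | exists theta : R,
     same_law P (normal_prob (theta * sigma ^+ 2) sigma)].

Definition Gamma_fun (p : R) : R :=
  (\int[lebesgue_measure]_(x in `]0%R, +oo[) (x `^ (p - 1) * expR (- x)))%R.

Definition gamma_pdf (p theta x : R) : R :=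
  expR (theta * x) * (- theta) `^ p * x `^ (p - 1) * \1_`]0%R, +oo[ x
  / Gamma_fun p.

Definition gamma_prob (p theta : R) : set RT -> \bar R :=
  fun A => (\int[lebesgue_measure]_(x in A) (gamma_pdf p theta x)%:E)%E.

Definition gamma_family (p : R) : set (probability RT R) :=
  [set P : probability RT R | exists2 theta : R,
     theta < 0 & same_law P (gamma_prob p theta)].

Definition translate_family (t : R) F : set (probability RT R) :=
  [set Q : probability RT R | exists2 P : probability RT R,
     F P & same_law Q (pushforward P (fun x : RT => (x + t : RT)))].

End exponential_families.

(* Main.v *)
Require Import Defs.
From HB Require Import structures.
From mathcomp Require Import all_boot all_order all_algebra.
From mathcomp Require Import all_classical all_reals all_analysis.
From mathcomp Require Import measurable_realfun lebesgue_integral_under.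
From mathcomp Require Import ring lra.
Import numFieldNormedType.Exports.
Import Order.TTheory GRing.Theory Num.Theory.
Local Open Scope classical_set_scope.
Local Open Scope ring_scope.

Set Implicit Arguments.
Unset Strict Implicit.
Unset Printing Implicit Defensive.

(** Differentiating F_th(x) = c(x) \int_(th, beta) e^(ux) mu(du) in th shows
    that mu has a density at th, and gives, with k = kappa'(th) and some N > 0,
      c(x) e^(th x) = N \int_(-oo, x] (k - t) e^(th t) nu(dt)   for all x,
    that is, dc + th c dx = N (k - x) nu(dx).  Subtracting these equations for
    th1 <> th2 yields c dx = a nu(dx) with a affine.  So wherever c > 0 the
    measure nu has density c / a, and c' / c is a quotient of two affine
    functions.  The set {c > 0} is up-closed and open, and a does not vanish on
    it.  If it is the whole line then a is constant and nu is Gaussian up to an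
    exponential factor; if it is ]t, +oo[ then a(t) = 0 and nu is a translated
    Gamma up to an exponential factor. *)

(** * Local comparison of increments *)

(** No regularity is available at the start: [nu] and [mu] are arbitrary measures and [c] is a bare
    function. So neither differential identity is taken literally. On the side of [mu], only the
    limit of mu(]th, th+h]) / h as h decreases to 0 is needed. Every x with c(x) > 0 gives a formula
    for this limit, and comparing the formulas produces a constant N free of x. Its inverse is that
    limit times the normalizing integral; it is nonzero because [nu] is not concentrated on the mean
    k. On the side of [nu], the equation between measures becomes a comparison of increments at a
    point z, with an error |y - z| (|c(z)| |y - z| + |G(y) - G(z)|), where G is a distribution
    function of [nu]. Differentiability of G and c is a consequence of two such comparisons wherever
    a(z) does not vanish. Right-continuity of G excludes a(z) = 0 when c(z) > 0. The Gamma integral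
    is never shown finite by direct estimates: its finiteness is read off from that of the Laplace
    transform. *)

Section local_analysis.
Context {R : realType}.
Implicit Types (f c G : R -> R) (x y z K : R).

Lemma quadratic_is_derive f z l K :
  (\forall y \near z, `|f y - f z - l * (y - z)| <= K * `|y - z| ^+ 2) ->
  is_derive z (1 : R) f l.
Proof.
move=> H.
have Hc : h^-1 *: (f (h *: (1 : R) + z) - f z) @[h --> 0^'] --> l.
  apply/cvgrPdist_le => /= e e0.
  have K0 : 0 < `|K| + 1 by rewrite ltr_wpDl.
  near=> h.
  have h0 : h != 0 by near: h; exact: nbhs_dnbhs_neq.
  have hn : 0 < `|h| by rewrite normr_gt0.
  have he : `|h| <= e / (`|K| + 1).
    near: h; apply: dnbhs0_le; exact: divr_gt0.
  have Hh : `|f (h + z) - f z - l * (h + z - z)| <= K * `|h + z - z| ^+ 2.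
    near: h; apply: nbhs_dnbhs.
    have : (h + z) @[h --> (0 : R)] --> z.
      rewrite -[X in _ --> X]add0r; apply: cvgD; [exact: cvg_id|exact: cvg_cst].
    by move/(_ _ H).
  rewrite addrK in Hh.
  rewrite [h *: _]mulr1 distrC.
  have -> : h^-1 *: (f (h + z) - f z) - l = h^-1 * (f (h + z) - f z - l * h).
    by rewrite mulrBr mulrCA mulVf// mulr1.
  rewrite normrM normfV ler_pdivrMl//; apply: (le_trans Hh).
  rewrite expr2 mulrCA ler_wpM2l//.
  rewrite ler_pdivlMr// in he.
  apply: le_trans he; rewrite mulrC ler_wpM2l//.
  by rewrite (le_trans (ler_norm _))// lerDl.
have Hd : derivable f z 1 by apply/cvg_ex; exists l.
by apply: DeriveDef => //; apply/cvg_lim.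
Unshelve. all: by end_near. Qed.

Section two_relations.
Variables (c G : R -> R) (z th1 th2 N1 N2 k1 k2 K : R).
Hypothesis th12 : th1 != th2.
(* First-order form at z of dc + th c dx = N (k - x) dG. *)
Let rel th N k := \forall y \near z,
  `|c y - c z + th * c z * (y - z) - N * (k - z) * (G y - G z)| <=
  K * `|y - z| * (`|c z| * `|y - z| + `|G y - G z|).
Hypothesis rel1 : rel th1 N1 k1.
Hypothesis rel2 : rel th2 N2 k2.
Let a := (N2 * (k2 - z) - N1 * (k1 - z)) / (th2 - th1).

Let th210 : th2 - th1 != 0. Proof. by rewrite subr_eq0 eq_sym. Qed.

(* The factor [`|c z|] in the error term matters: where c vanishes but a does
   not, it forces G to be locally constant (increment_cst). *)
Lemma increment_relation : exists2 L, 0 <= L & \forall y \near z,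
  `|c z * (y - z) - a * (G y - G z)| <=
  L * `|y - z| * (`|c z| * `|y - z| + `|G y - G z|).
Proof.
have d0 : 0 < `|th2 - th1| by rewrite normr_gt0.
(* Subtraction cancels [c y - c z]; twice the error remains, to be divided by the factor [th2 - th1]
   left in front of [c z * (y - z)]. *)
exists (2 * `|K| / `|th2 - th1|); first by rewrite divr_ge0// mulr_ge0.
near=> y.
have H1 : `|c y - c z + th1 * c z * (y - z) - N1 * (k1 - z) * (G y - G z)| <=
  K * `|y - z| * (`|c z| * `|y - z| + `|G y - G z|) by near: y.
have H2 : `|c y - c z + th2 * c z * (y - z) - N2 * (k2 - z) * (G y - G z)| <=
  K * `|y - z| * (`|c z| * `|y - z| + `|G y - G z|) by near: y.
set Q := `|c z| * _ + _ in H1 H2 *.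
have -> : 2 * `|K| / `|th2 - th1| * `|y - z| * Q =
  2 * (`|K| * `|y - z| * Q) / `|th2 - th1| by ring.
rewrite ler_pdivlMr// -normrM.
have -> : (c z * (y - z) - a * (G y - G z)) * (th2 - th1) =
   (c y - c z + th2 * c z * (y - z) - N2 * (k2 - z) * (G y - G z)) -
   (c y - c z + th1 * c z * (y - z) - N1 * (k1 - z) * (G y - G z)).
  by rewrite /a; field.
apply: (le_trans (ler_normB _ _)); apply: (le_trans (lerD H2 H1)).
rewrite -mulr2n -[leLHS]mulr_natl ler_wpM2l// -!mulrA ler_wpM2r ?ler_norm//.
by rewrite mulr_ge0// addr_ge0// mulr_ge0.
Unshelve. all: by end_near. Qed.

(** If [a = 0], dividing the relation by y - z > 0 bounds |c z| by L (|c z| (y - z) + |G y - G z|),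
    which is arbitrarily small at suitable points just right of z. *)
Lemma slope_neq0 : c z != 0 ->
  (forall e, 0 < e -> exists2 y, z < y < z + e & `|G y - G z| < e) -> a != 0.
Proof.
move=> c0 Gz; apply/eqP => a0.
have [L L0] := increment_relation; rewrite a0.
move=> /nbhs_ballP[d /= d0 H].
have cz0 : 0 < `|c z| by rewrite normr_gt0.
(* These bounds keep each of the two error terms below a quarter of |c z|. *)
pose e := Num.min d (Num.min (1 / (4 * (L + 1))) (`|c z| / (4 * (L + 1)))).
have L1 : 0 < 4 * (L + 1) by rewrite mulr_gt0// ltr_wpDl.
have e0 : 0 < e by rewrite !lt_min d0 !divr_gt0.
have [y /andP[zy yze] GG] := Gz e e0.
have h0 : 0 < y - z by rewrite subr_gt0.
have he : y - z < e by rewrite ltrBlDl.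
have /H : ball z d y.
  rewrite /ball /= distrC gtr0_norm//; apply: (lt_le_trans he).
  by rewrite ge_min lexx.
rewrite mul0r subr0 normrM [`|y - z|]gtr0_norm// [L * _]mulrC -mulrA mulrC.
rewrite ler_pM2l//.
have {}he : (y - z) * (4 * (L + 1)) < 1.
  rewrite -ltr_pdivlMr//; apply: (lt_le_trans he).
  by rewrite !ge_min lexx orbT.
have {}GG : `|G y - G z| * (4 * (L + 1)) < `|c z|.
  rewrite -ltr_pdivlMr//; apply: (lt_le_trans GG).
  by rewrite !ge_min lexx !orbT.
apply/negP; rewrite -ltNge.
have {}he : `|c z| * ((y - z) * (4 * (L + 1))) < `|c z| by rewrite gtr_pMr.
have g0 : 0 <= `|G y - G z| by [].
have : 0 <= `|c z| * (y - z) by rewrite mulr_ge0// ltW.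
move: g0 he GG L0 cz0; set u := `|G y - G z|; set v := `|c z|; set w := y - z.
by move=> *; nra.
Qed.

Hypothesis a0 : a != 0.

(** Near z the factor L |y - z| is at most |a| / 2, so the part of the error containing |G y - G z|
    is absorbed by a (G y - G z). What remains is proportional to |c z|. *)
Lemma increment_bound : exists2 L, 0 <= L & \forall y \near z,
  `|(G y - G z) - c z / a * (y - z)| <= L * `|c z| * `|y - z| ^+ 2 /\
  `|G y - G z| <= L * `|c z| * `|y - z|.
Proof.
have [L L0 H] := increment_relation.
have a0' : 0 < `|a| by rewrite normr_gt0.
(* With w = |c z| |y - z| and g = |G y - G z|, absorption leaves |a| g <= w + |a| (w + g) / 2, that
   is g <= M w. *)
pose M := 2 / `|a| + 1.
have M0 : 0 <= M by rewrite addr_ge0// divr_ge0.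
have LaM : 0 <= L / `|a| * (1 + M) by rewrite mulr_ge0 ?divr_ge0// addr_ge0.
exists (M + L / `|a| * (1 + M)); first by rewrite addr_ge0.
have e0 : 0 < `|a| / (2 * (L + 1)) by rewrite divr_gt0// mulr_gt0// ltr_wpDl.
near=> y.
have Hy : `|c z * (y - z) - a * (G y - G z)| <=
  L * `|y - z| * (`|c z| * `|y - z| + `|G y - G z|) by near: y.
have hy : `|y - z| <= `|a| / (2 * (L + 1)).
  by rewrite distrC ltW//; near: y; exact: nbhsx_ballx.
have hL : L * `|y - z| <= `|a| / 2.
  move: hy; rewrite ler_pdivlMr ?mulr_gt0// ?ltr_wpDl// => hy.
  have : 0 <= `|y - z| by []. 
  by move=> *; lra.
have cw0 : 0 <= `|c z| * `|y - z| by rewrite mulr_ge0.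
have GM : `|G y - G z| <= M * (`|c z| * `|y - z|).
  have : `|a| * `|G y - G z| <= `|c z| * `|y - z| + 
      `|a| / 2 * (`|c z| * `|y - z| + `|G y - G z|).
    rewrite -!normrM.
    have -> : a * (G y - G z) = c z * (y - z) - (c z * (y - z) - a * (G y - G z)).
      by ring.
    apply: (le_trans (ler_normB _ _)); rewrite lerD2l; apply: (le_trans Hy).
    by rewrite -normrM ler_wpM2r// addr_ge0.
  move=> H1; rewrite -(ler_pM2l a0') /M.
  have -> : `|a| * ((2 / `|a| + 1) * (`|c z| * `|y - z|)) =
    (2 + `|a|) * (`|c z| * `|y - z|) by field; rewrite gt_eqF.
  by move: H1; set u := `|c z| * _; set v := `|G _ - _| => H1; nra.
split; last first.
  rewrite -mulrA; apply: (le_trans GM); rewrite ler_wpM2r//.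
  by rewrite lerDl.
have -> : G y - G z - c z / a * (y - z) =
   - (c z * (y - z) - a * (G y - G z)) / a by field.
rewrite normrM normrN normfV ler_pdivrMr//; apply: (le_trans Hy).
apply: (@le_trans _ _ (L * `|y - z| * ((1 + M) * (`|c z| * `|y - z|)))).
  rewrite ler_wpM2l ?mulr_ge0//; move: GM; set v := `|G _ - _| => GM.
  by rewrite mulrDl mul1r lerD2l.
have -> : L * `|y - z| * ((1 + M) * (`|c z| * `|y - z|)) =
  (L / `|a| * (1 + M)) * `|c z| * `|y - z| ^+ 2 * `|a|.
  by field; rewrite gt_eqF.
by rewrite ler_wpM2r// ler_wpM2r ?exprn_ge0// ler_wpM2r// lerDr.
Unshelve. all: by end_near. Qed.

Lemma increment_derive : is_derive z (1 : R) G (c z / a).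
Proof.
have [L L0 H] := increment_bound.
apply: (@quadratic_is_derive _ _ _ (L * `|c z|)).
by apply: filterS H => y [].
Qed.

(** Replacing the increment of [G] in the first relation by its linear part costs only a
    second-order term, so [c] inherits a derivative although nothing was assumed about its
    regularity. *)
Lemma relation_derive :
  is_derive z (1 : R) c ((N1 * (k1 - z) / a - th1) * c z).
Proof.
have [L L0 H] := increment_bound.
pose C := `|K| * (`|c z| + L * `|c z|) + `|N1 * (k1 - z)| * (L * `|c z|).
apply: (@quadratic_is_derive _ _ _ C).
near=> y.
have [h1 h2] : `|(G y - G z) - c z / a * (y - z)| <= L * `|c z| * `|y - z| ^+ 2 /\
  `|G y - G z| <= L * `|c z| * `|y - z| by near: y.
have H1 : `|c y - c z + th1 * c z * (y - z) - N1 * (k1 - z) * (G y - G z)| <=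
  K * `|y - z| * (`|c z| * `|y - z| + `|G y - G z|) by near: y.
have -> : c y - c z - (N1 * (k1 - z) / a - th1) * c z * (y - z) =
  (c y - c z + th1 * c z * (y - z) - N1 * (k1 - z) * (G y - G z)) +
  N1 * (k1 - z) * ((G y - G z) - c z / a * (y - z)) by field.
apply: (le_trans (ler_normD _ _)); rewrite /C mulrDl; apply: lerD.
  apply: (le_trans H1).
  apply: (@le_trans _ _ (`|K| * `|y - z| *
     (`|c z| * `|y - z| + L * `|c z| * `|y - z|))); last first.
    by rewrite le_eqVlt; apply/orP; left; apply/eqP; ring.
  apply: (@le_trans _ _ (`|K| * `|y - z| * (`|c z| * `|y - z| + `|G y - G z|))).
    by rewrite -!mulrA ler_wpM2r ?ler_norm// mulr_ge0// addr_ge0// mulr_ge0.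
  by rewrite ler_wpM2l ?mulr_ge0// lerD2l.
by rewrite normrM -[leRHS]mulrA ler_wpM2l.
Unshelve. all: by end_near. Qed.

Lemma increment_cst : c z = 0 -> \forall y \near z, G y = G z.
Proof.
move=> c0; have [L L0] := increment_bound; rewrite c0.
apply: filterS => y [_]; rewrite normr0 mulr0 mul0r normr_le0.
by rewrite subr_eq0 => /eqP.
Qed.

End two_relations.
End local_analysis.

(** * Exponential moments and tilted laws *)

Section exponential_moments.
Context {R : realType} (nu : {measure set (measurableTypeR R) -> \bar R}).
Notation RT := (measurableTypeR R).
Implicit Types (th s e x : R) (B : set RT).

Lemma measurable_expRM th : measurable_fun [set: RT] (fun x : RT => expR (th * x)).
Proof.
by apply: measurableT_comp => //; apply: measurable_funM => //; exact: measurable_cst.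
Qed.

Lemma laplace_integrable th : (laplace nu th < +oo)%E ->
  nu.-integrable setT (EFin \o (fun x : RT => expR (th * x))).
Proof.
move=> Lth; apply/integrableP; split.
  by apply/measurable_EFinP; exact: measurable_expRM.
under eq_integral do rewrite /= ger0_norm ?expR_ge0//.
exact: Lth.
Qed.

(** The margin 2e pays twice: e for moving the parameter around [th], and e for dominating the
    factor x that differentiation brings down. *)
Lemma laplace_near th : laplace_interior nu th ->
  exists2 e, 0 < e & forall s, `|s - th| <= 2 * e -> (laplace nu s < +oo)%E.
Proof.
move=> /nbhs_ballP[d /= d0 H]; exists (d / 4); first by rewrite divr_gt0.
move=> s sth; apply: H; rewrite /ball/= distrC; apply: (le_lt_trans sth).
by lra.
Qed.

(** Both |x| <= e^(-1) exp(e |x|) and s x <= th x + e |x| hold; the total exponent th x + 2e |x| is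
    one of the two on the right, according to the sign of x. *)
Lemma expRM_abs_bound th e s x : 0 < e -> `|s - th| <= e ->
  `|x * expR (s * x)| <=
  e^-1 * (expR ((th + 2 * e) * x) + expR ((th - 2 * e) * x)).
Proof.
move=> e0 sth; rewrite normrM [`|expR _|]ger0_norm ?expR_ge0//.
have h1 : `|x| <= e^-1 * expR (e * `|x|).
  rewrite mulrC ler_pdivlMr// mulrC.
  by apply: le_trans (expR_ge1Dx _); rewrite lerDr.
have h2 : expR (s * x) <= expR (th * x + e * `|x|).
  rewrite ler_expR -lerBlDl -mulrBl; apply: (le_trans (ler_norm _)).
  by rewrite normrM ler_wpM2r.
apply: (@le_trans _ _ (e^-1 * expR (e * `|x|) * expR (th * x + e * `|x|))).
  by apply: ler_pM => //; exact: expR_ge0.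
rewrite -mulrA ler_pM2l ?invr_gt0// -expRD.
have [x0|x0] := leP 0 x.
  rewrite ger0_norm//.
  have -> : e * x + (th * x + e * x) = (th + 2 * e) * x by ring.
  by rewrite lerDl expR_ge0.
rewrite ltr0_norm//.
have -> : e * - x + (th * x + e * - x) = (th - 2 * e) * x by ring.
by rewrite lerDr expR_ge0.
Qed.

Lemma integrable_dominator th e : 0 < e ->
  (laplace nu (th + 2 * e) < +oo)%E -> (laplace nu (th - 2 * e) < +oo)%E ->
  nu.-integrable setT (EFin \o (fun x : RT =>
    e^-1 * (expR ((th + 2 * e) * x) + expR ((th - 2 * e) * x)))).
Proof.
move=> e0 /laplace_integrable h1 /laplace_integrable h2.
have := integrableZl measurableT e^-1 (integrableD measurableT h1 h2).
by apply: eq_integrable => // x _ /=; rewrite EFinM EFinD.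
Qed.

Lemma moment_integrable th : laplace_interior nu th ->
  nu.-integrable setT (EFin \o (fun x : RT => x * expR (th * x))).
Proof.
move=> /laplace_near[e e0 H].
have i1 : (laplace nu (th + 2 * e) < +oo)%E.
  by apply: H; rewrite addrC addKr ger0_norm// mulr_ge0// ltW.
have i2 : (laplace nu (th - 2 * e) < +oo)%E.
  by apply: H; rewrite addrC addKr normrN ger0_norm// mulr_ge0// ltW.
apply: (le_integrable measurableT _ _ (integrable_dominator e0 i1 i2)).
  by apply/measurable_EFinP/measurable_funM => //; exact: measurable_expRM.
move=> x _ /=; rewrite lee_fin.
apply: le_trans (ler_norm _); apply: expRM_abs_bound => //.
by rewrite subrr normr0 ltW.
Qed.

Lemma exp_integral_derive th B : measurable B -> laplace_interior nu th ->
  is_derive th (1 : R) (fun s => \int[nu]_(x in B) expR (s * x))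
    (\int[nu]_(x in B) (x * expR (th * x))).
Proof.
move=> mB /laplace_near[e e0 H].
have i1 : (laplace nu (th + 2 * e) < +oo)%E.
  by apply: H; rewrite addrC addKr ger0_norm// mulr_ge0// ltW.
have i2 : (laplace nu (th - 2 * e) < +oo)%E.
  by apply: H; rewrite addrC addKr normrN ger0_norm// mulr_ge0// ltW.
pose g x := e^-1 * (expR ((th + 2 * e) * x) + expR ((th - 2 * e) * x)).
have Hth : `]th - e, th + e[%classic th.
  by rewrite /= in_itv/= ltrBlDr ltrDl e0.
have Hi s : `]th - e, th + e[%classic s -> `|s - th| <= e.
  by rewrite /= in_itv/= => /andP[? ?]; rewrite ler_norml; lra.
have d1 s (x : RT) : is_derive s (1 : R) (fun u : R => expR (u * x)) (x * expR (s * x)).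
  have h : is_derive s (1 : R) (fun u : R => u * x) x.
    rewrite (_ : (fun u => u * x) = (fun u : R => u) * cst x)//.
    by apply: is_derive_eq; rewrite /GRing.scale/= mulr0 add0r mulr1.
  by rewrite mulrC; exact: (is_derive1_comp (is_derive_expR _) h).
have int s : `]th - e, th + e[%classic s ->
    nu.-integrable B (EFin \o (fun x : RT => expR (s * x))).
  move=> /Hi se; apply: (integrableS _ _ (@subsetT _ _)) => //.
  by apply: laplace_integrable; apply: H; apply: (le_trans se); lra.
have der s x : `]th - e, th + e[%classic s -> B x ->
  derivable (fun u : R => expR (u * x)) s 1 by move=> _ _; exact: ex_derive.
have g0 x : 0 <= g x.
  by rewrite mulr_ge0 ?invr_ge0 ?ltW// addr_gt0// expR_gt0.
have intg : nu.-integrable B (EFin \o g).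
  apply: (integrableS _ _ (@subsetT _ _)) => //.
  exact: integrable_dominator.
have gub s (x : RT) : `]th - e, th + e[%classic s -> B x ->
    `|partial1of2 (fun s (x : RT) => expR (s * x)) s x| <= g x.
  move=> /Hi se _; rewrite partial1of2E.
  by rewrite derive_val; exact: expRM_abs_bound.
apply: DeriveDef.
  exact: (derivable_under_integral mB Hth int der g0 intg gub).
rewrite -derive1E (differentiation_under_integral mB Hth int der g0 intg gub).
by apply: eq_Rintegral => x _; rewrite partial1of2E derive_val.
Qed.

End exponential_moments.

Lemma gt0_integral_eq0 (R : realType) d (T : measurableType d)
    (m : {measure set T -> \bar R}) (D : set T) (f : T -> R) :
  measurable D -> measurable_fun D f -> (forall y, D y -> 0 < f y) ->
  (\int[m]_(y in D) (f y)%:E = 0)%E -> m D = 0%E.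
Proof.
move=> mD mf f0 I0.
have : (\int[m]_(y in D) `|(f y)%:E| = 0)%E.
  rewrite -[RHS]I0; apply: eq_integral => x /[!inE] Dx.
  by rewrite gee0_abs// lee_fin ltW// f0.
move/(ae_eq_integral_abs m mD _).1 => /(_ _)[|N [mN N0 DN]].
  exact/measurable_EFinP.
apply: (subset_measure0 _ _ _ N0) => // x Dx; apply: DN => /(_ Dx) [fx0].
by have := f0 _ Dx; rewrite fx0 ltxx.
Qed.

Section tilted_laws.
Context {R : realType} (nu : {measure set (measurableTypeR R) -> \bar R}).
Notation RT := (measurableTypeR R).
Implicit Types (th x : R) (A B : set RT).

Hypothesis nu_not_point : ~ concentrated_on_a_point nu.

(** A zero integral would make [nu] null, and the null measure counts as concentrated on a point. *)
Lemma laplace_gt0 th : (0 < laplace nu th)%E.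
Proof.
rewrite lt_neqAle integral_ge0 ?andbT; last by move=> x _; rewrite lee_fin expR_ge0.
apply/eqP => /esym L0; apply: nu_not_point; exists 0.
apply: (@subset_measure0 _ _ _ _ _ [set: RT]) => //; first exact: measurableC.
apply: (@gt0_integral_eq0 _ _ _ nu _ (fun x => expR (th * x))) => //.
  exact: measurable_expRM.
by move=> x _; exact: expR_gt0.
Qed.

Lemma interior_laplace th : laplace_interior nu th -> (laplace nu th < +oo)%E.
Proof. exact: (@interior_subset _ [set s | (laplace nu s < +oo)%E]). Qed.

Definition exp_integral A th := \int[nu]_(x in A) expR (th * x).

Lemma exp_integral_integrable th A : measurable A -> laplace_interior nu th ->
  nu.-integrable A (EFin \o (fun x : RT => expR (th * x))).
Proof.
move=> mA /interior_laplace/laplace_integrable.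
by apply: integrableS.
Qed.

Lemma EFin_exp_integral th A : measurable A -> laplace_interior nu th ->
  (exp_integral A th)%:E = (\int[nu]_(x in A) (expR (th * x))%:E)%E.
Proof.
move=> mA Hth; rewrite /exp_integral /Rintegral fineK//.
by apply: integrable_fin_num => //; exact: exp_integral_integrable.
Qed.

Lemma exp_integral_ge0 th A : 0 <= exp_integral A th.
Proof. by apply: Rintegral_ge0 => x _; exact: expR_ge0. Qed.

Lemma exp_integralT_gt0 th : laplace_interior nu th -> 0 < exp_integral setT th.
Proof. by move=> Hth; rewrite -lte_fin EFin_exp_integral//; exact: laplace_gt0. Qed.

Lemma tiltE th A : measurable A -> laplace_interior nu th ->
  tilt nu th A = (exp_integral A th / exp_integral setT th)%:E.
Proof.
move=> mA Hth; rewrite /tilt /cumulant -/(exp_integral setT th).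
under eq_integral do rewrite expRD expRN lnK ?posrE ?exp_integralT_gt0// EFinM.
rewrite ge0_integralZr//; first by rewrite -EFin_exp_integral.
- by apply/measurable_EFinP/measurable_funTS; exact: measurable_expRM.
- by rewrite lee_fin invr_ge0; exact: (exp_integral_ge0 th setT).
Qed.

Lemma exp_integral_eq0 th A : measurable A -> laplace_interior nu th ->
  exp_integral A th = 0 <-> nu A = 0%E.
Proof.
move=> mA Hth; split => [E0|A0].
  apply: (@gt0_integral_eq0 _ _ _ nu _ (fun x => expR (th * x))) => //.
  - by apply: measurable_funTS; exact: measurable_expRM.
  - by move=> x _; exact: expR_gt0.
  by rewrite -EFin_exp_integral// E0.
apply: EFin_inj; rewrite EFin_exp_integral// null_set_integral//.
by apply/measurable_EFinP/measurable_funTS; exact: measurable_expRM.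
Qed.

Lemma centered_moment_integrable k th A : measurable A ->
  laplace_interior nu th ->
  nu.-integrable A (EFin \o (fun t : RT => (k - t) * expR (th * t))).
Proof.
move=> mA Hth.
have i1 := integrableZl mA k (exp_integral_integrable mA Hth).
have i2 : nu.-integrable A (EFin \o (fun t : RT => t * expR (th * t))).
  by apply: integrableS (moment_integrable Hth).
by apply: eq_integrable (integrableB mA i1 i2) => // t _ /=; rewrite mulrBl.
Qed.

Lemma centered_moment_integral k th A : measurable A ->
  laplace_interior nu th ->
  \int[nu]_(t in A) ((k - t) * expR (th * t)) =
  k * exp_integral A th - \int[nu]_(t in A) (t * expR (th * t)).
Proof.
move=> mA Hth.
rewrite /exp_integral -RintegralZl//; last exact: exp_integral_integrable.
rewrite -RintegralB//; first by apply: eq_Rintegral => t _; rewrite mulrBl.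
  have := integrableZl mA k (exp_integral_integrable mA Hth).
  by apply: eq_integrable => // t _ /=; rewrite EFinM.
by apply: integrableS (moment_integrable Hth).
Qed.

(** Otherwise the rays ]-oo, n], which exhaust the line, would make [nu] null. Through [weight_eq0]
    this supplies a point where [c] is positive. *)
Lemma exists_left_ray_neq0 : exists x : R, nu `]-oo, x]%classic != 0%E.
Proof.
apply: contrapT => H; apply: nu_not_point; exists 0.
apply: (@subset_measure0 _ _ _ _ _ [set: RT]) => //; first exact: measurableC.
have : (nu \o (fun n => `]-oo, n%:R]%classic : set RT)) n @[n --> \oo] -->
    nu (\bigcup_n `]-oo, n%:R]%classic).
  apply: nondecreasing_cvg_mu => //.
  - by apply: bigcup_measurable.
  - move=> n m nm; apply/subsetPset => x /=; rewrite !in_itv/= => /le_trans; apply.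
    by rewrite ler_nat.
have -> : \bigcup_n `]-oo, n%:R]%classic = [set: RT].
  apply/seteqP; split => // x _.
  exists (Num.truncn `|x|).+1 => //=; rewrite in_itv/= ltW//.
  by apply: le_lt_trans (ler_norm _) _; exact: truncnS_gt.
rewrite (_ : nu \o _ = cst 0%E); last first.
  apply/funext => n /=; apply: contrapT => /eqP n0; apply: H.
  by exists n%:R.
by move/cvg_unique => /(_ (@ereal_hausdorff R) _ (@cvg_cst _ _ _ _ _)).
Qed.

End tilted_laws.

(** * From the tail representation to the weighted exponential identity *)

Section tail_representation.
Context {R : realType} (nu mu : {measure set (measurableTypeR R) -> \bar R}).
Notation RT := (measurableTypeR R).
Variables (beta : \bar R) (c : R -> R).
Implicit Types (th x h : R).
Hypothesis nu_not_point : ~ concentrated_on_a_point nu.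
Hypothesis interior_lt : forall th, laplace_interior nu th -> (th%:E < beta)%E.
Hypothesis interior_neq0 : exists th, laplace_interior nu th.

Let tail th : set RT := [set u : RT | (th < u)%R /\ ((u : R)%:E < beta)%E].

Hypothesis cdf_eq : forall x th, laplace_interior nu th ->
  tilt nu th `]-oo, x] =
  ((c x)%:E * \int[mu]_(u in tail th) (expR (u * x))%:E)%E.

Let cdf th x := exp_integral nu `]-oo, x] th / exp_integral nu setT th.

Let measurable_tail th : measurable (tail th).
Proof.
have -> : tail th = `]th, +oo[%classic `&` [set u : RT | ((u : R)%:E < beta)%E].
  by apply/seteqP; split => u /=; rewrite in_itv/= andbT.
exact: emeasurable_fun_infty_o.
Qed.

Let measurable_kernel x (D : set RT) : measurable_fun D (fun u : RT => expR (u * x)).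
Proof.
apply: measurable_funTS; apply: measurableT_comp => //.
by apply: measurable_funM => //; exact: measurable_cst.
Qed.

Let emeasurable_kernel x (D : set RT) :
  measurable_fun D (fun u : RT => (expR (u * x))%:E).
Proof. exact/measurable_EFinP. Qed.

Let kernel_ge0 x (D : set RT) u : D u -> (0 <= (expR (u * x))%:E)%E.
Proof. by rewrite lee_fin expR_ge0. Qed.

Let cdfE x th : laplace_interior nu th ->
  (cdf th x)%:E = ((c x)%:E * \int[mu]_(u in tail th) (expR (u * x))%:E)%E.
Proof. by move=> Hth; rewrite -cdf_eq// tiltE. Qed.

Let cdf_ge0 th x : 0 <= cdf th x.
Proof. by rewrite divr_ge0// exp_integral_ge0. Qed.

(** The integrand is positive, so vanishing at one x means that [tail th] is [mu]-null. Then the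
    distribution function would vanish at every y, against [exists_left_ray_neq0]. *)
Let tail_gt0 th x : laplace_interior nu th ->
  (0 < \int[mu]_(u in tail th) (expR (u * x))%:E)%E.
Proof.
move=> Hth; rewrite lt_neqAle integral_ge0 ?andbT; last exact: kernel_ge0.
apply/eqP => /esym I0.
have mu0 : mu (tail th) = 0%E.
  by apply: (@gt0_integral_eq0 _ _ _ mu _ (fun u => expR (u * x))) => // u _; exact: expR_gt0.
have [y /eqP] := exists_left_ray_neq0 nu_not_point; apply.
rewrite -(exp_integral_eq0 _ Hth)//.
have /eqP := cdfE y Hth.
rewrite null_set_integral// mule0 eqe mulf_eq0 invr_eq0 (gt_eqF (exp_integralT_gt0 _ _))//.
by rewrite orbF => /eqP.
Qed.

Lemma weight_ge0 x : 0 <= c x.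
Proof.
have [th Hth] := interior_neq0.
rewrite leNgt; apply/negP => cx0.
have := cdf_ge0 th x; rewrite -lee_fin cdfE// leNgt => /negP; apply.
by rewrite nmule_rlt0 ?lte_fin// tail_gt0.
Qed.

(** The tail integral is positive but possibly infinite; with the convention 0 * oo = 0 its product
    with [c x] still vanishes exactly when [c x] does. *)
Lemma weight_eq0 x : (c x == 0) = (nu `]-oo, x]%classic == 0%E).
Proof.
have [th Hth] := interior_neq0.
have -> : (nu `]-oo, x]%classic == 0%E) = (cdf th x == 0).
  rewrite mulf_eq0 invr_eq0 (gt_eqF (exp_integralT_gt0 _ _))// orbF.
  by apply/eqP/eqP => /(exp_integral_eq0 _ Hth)/(_); apply.
rewrite -[RHS]eqe cdfE// mule_eq0 (gt_eqF (tail_gt0 _ Hth)) orbF.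
by rewrite eqe.
Qed.

Let interior_right th : laplace_interior nu th ->
  \forall h \near 0^'+, laplace_interior nu (th + h).
Proof.
move=> Hth.
have cv : th + h @[h --> 0^'+] --> th.
  apply: cvg_at_right_filter; rewrite -[X in _ --> X]addr0.
  by apply: cvgD; [exact: cvg_cst|exact: cvg_id].
have nb : nbhs th (laplace_interior nu).
  by apply: open_nbhs_nbhs; split => //; exact: open_interior.
exact: (cv _ nb).
Qed.

(** The difference of the two tail integrals is the integral over ]th, th+h], where u x stays within
    |x| h of th x. *)
Let cdf_increment th h x : 0 < c x -> 0 < h ->
  laplace_interior nu th -> laplace_interior nu (th + h) ->
  c x * expR (th * x - `|x| * h) * fine (mu `]th, (th + h)%R]%classic) <=
    cdf th x - cdf (th + h) x <=
  c x * expR (th * x + `|x| * h) * fine (mu `]th, (th + h)%R]%classic).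
Proof.
move=> cx h0 H1 H2.
pose I := (\int[mu]_(u in `]th, (th + h)%R]) (expR (u * x))%:E)%E.
pose J := (\int[mu]_(u in tail (th + h)) (expR (u * x))%:E)%E.
have tailU : tail th = (`]th, th + h]%classic : set RT) `|` tail (th + h).
  apply/seteqP; split => u /=; rewrite in_itv/=.
    move=> [thu ub]; have [uh|uh] := leP u (th + h); first by left; rewrite thu.
    by right.
  move=> [/andP[thu uh]|[thu ub]].
    by split => //; apply: le_lt_trans (interior_lt H2); rewrite lee_fin.
  by split => //; apply: lt_trans thu; rewrite ltrDl.
have IJ : (\int[mu]_(u in tail th) (expR (u * x))%:E = I + J)%E.
  rewrite tailU ge0_integral_setU//.
  apply/disj_setPS => u /= [] /=; rewrite in_itv/= => /andP[_ u1] [u2 _].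
  by move: u2; rewrite ltNge u1.
have I0 : (0 <= I)%E by apply: integral_ge0; exact: kernel_ge0.
have J0 : (0 <= J)%E by apply: integral_ge0; exact: kernel_ge0.
(* Since [c x > 0], an infinite tail integral would make the real number [cdf] infinite. *)
have Jfin : J \is a fin_num.
  rewrite ge0_fin_numE// ltNge leye_eq; apply/negP => /eqP Joo.
  by have := cdfE x H2; rewrite -/J Joo gt0_muley// lte_fin.
have Ifin : I \is a fin_num.
  rewrite ge0_fin_numE// ltNge leye_eq; apply/negP => /eqP Ioo.
  have := cdfE x H1; rewrite IJ Ioo addye ?gt0_muley ?lte_fin//.
  by rewrite gt_eqF// (lt_le_trans _ J0).
have -> : cdf th x - cdf (th + h) x = c x * fine I.
  apply: EFin_inj; rewrite EFinB cdfE// cdfE// IJ -/J.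
  rewrite muleDr// -?addeA ?ge0_adde_def ?inE//.
  by rewrite subee ?adde0 ?EFinM ?fineK// fin_numM.
have ker u : `]th, th + h]%classic u ->
    expR (th * x - `|x| * h) <= expR (u * x) <= expR (th * x + `|x| * h).
  rewrite /= in_itv/= => /andP[u1 u2]; rewrite !ler_expR.
  have : `|(u - th) * x| <= `|x| * h.
    rewrite normrM mulrC ler_wpM2l// gtr0_norm ?subr_gt0//.
    by rewrite lerBlDl.
  by rewrite ler_norml mulrBl => /andP[a b]; apply/andP; split; lra.
have mI : measurable (`]th, th + h]%classic : set RT) by [].
have lI : ((expR (th * x - `|x| * h))%:E * mu `]th, (th + h)%R]%classic <= I)%E.
  rewrite -integral_cst//; apply: ge0_le_integral => //.
  - by move=> u _; rewrite lee_fin expR_ge0.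
  - by move=> u /ker/andP[]; rewrite lee_fin.
(* The lower bound [lI] transfers the finiteness of [I] to the mass of the interval. *)
have mfin : mu `]th, (th + h)%R]%classic \is a fin_num.
  rewrite ge0_fin_numE// ltNge leye_eq; apply/negP => /eqP moo.
  move: lI; rewrite moo gt0_muley ?lte_fin ?expR_gt0// leye_eq => /eqP Ioo.
  by move: Ifin; rewrite Ioo.
have uI : (I <= (expR (th * x + `|x| * h))%:E * mu `]th, (th + h)%R]%classic)%E.
  rewrite -integral_cst//; apply: ge0_le_integral => //.
  by move=> u /ker/andP[]; rewrite lee_fin.
rewrite -!mulrA !ler_pM2l// -!lee_fin !EFinM fineK// fineK//.
by rewrite lI uI.
Qed.

Let mean th := (\int[nu]_x (x * expR (th * x))) / exp_integral nu setT th.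

Let cdf_derive th x : laplace_interior nu th ->
  is_derive th (1 : R) (cdf ^~ x)
    (- (\int[nu]_(t in `]-oo, x]) ((mean th - t) * expR (th * t))
        / exp_integral nu setT th)).
Proof.
move=> Hth.
have L0 : exp_integral nu setT th != 0 by rewrite gt_eqF// exp_integralT_gt0.
have dA : is_derive th (1 : R) (fun s => exp_integral nu `]-oo, x] s)
  (\int[nu]_(t in `]-oo, x]) (t * expR (th * t))) by exact: exp_integral_derive.
have dL : is_derive th (1 : R) (fun s => exp_integral nu setT s)
  (\int[nu]_t (t * expR (th * t))) by exact: exp_integral_derive.
have := is_deriveM dA (is_deriveV L0 dL).
have -> : (fun s => exp_integral nu `]-oo, x] s) * (fun s => (exp_integral nu setT s)^-1) = cdf ^~ x.
  by [].
move=> /is_derive_eq; apply; rewrite /GRing.scale/=.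
rewrite centered_moment_integral// /mean.
by field.
Qed.

(* The left-hand side does not depend on x, hence neither does the limit. *)
Let density_cvg th x : 0 < c x -> laplace_interior nu th ->
  fine (mu `]th, (th + h)%R]%classic) / h @[h --> 0^'+] -->
  (\int[nu]_(t in `]-oo, x]) ((mean th - t) * expR (th * t)) /
    exp_integral nu setT th) / (c x * expR (th * x)).
Proof.
move=> cx Hth.
have p0 : 0 < c x * expR (th * x) by rewrite mulr_gt0// expR_gt0.
set D := (X in X / (c x * _)).
have slope : (cdf th x - cdf (th + h) x) / h @[h --> 0^'+] --> D.
  apply: cvg_dnbhs_at_right.
  have [/cvg_ex[/= l cl] Dl] := cdf_derive x Hth.
  have {}Dl : l = - D by rewrite -Dl; apply: esym; apply/cvg_lim.
  rewrite (_ : (fun h => _) =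
    - (fun h : R => h^-1 *: (cdf (h *: (1 : R) + th) x - cdf th x))).
    by rewrite -[D]opprK -Dl; exact: cvgN cl.
  apply/funext => h; rewrite fctE [h *: _]mulr1 [h + th]addrC.
  by rewrite -[in RHS]scalerN opprB /GRing.scale/= mulrC.
(* Solved for the mass of [mu], the bounds of [cdf_increment] differ from the difference quotient by
   the factors exp(- |x| h) and exp(|x| h), which tend to 1. *)
have slope_exp (d : R) : (cdf th x - cdf (th + h) x) / h / (c x * expR (th * x)) *
    expR (d * h) @[h --> 0^'+] --> D / (c x * expR (th * x)).
  rewrite -[X in _ --> X]mulr1; apply: cvgM.
    by apply: cvgM => //; exact: cvg_cst.
  have : expR (d * h) @[h --> (0 : R)] --> expR (d * 0).
    apply: (cvg_comp _ expR); last exact: continuous_expR.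
    by apply: cvgM; [exact: cvg_cst|exact: cvg_id].
  by rewrite mulr0 expR0 => /cvg_at_right_filter.
apply: (squeeze_cvgr _ (slope_exp (- `|x|)) (slope_exp `|x|)).
near=> h.
have h0 : 0 < h by near: h; exact: nbhs_right_gt.
have H2 : laplace_interior nu (th + h) by near: h; exact: interior_right.
have := cdf_increment cx h0 Hth H2.
set m := fine _; set d := cdf _ _ - _.
rewrite expRD expRD !expRN !mulrA => /andP[lo up].
have e0 : 0 < expR (`|x| * h) by exact: expR_gt0.
rewrite mulNr expRN; apply/andP; split.
  rewrite ler_pdivrMr// ler_pdivrMr// ler_pdivrMr//.
  apply: (le_trans up); rewrite le_eqVlt; apply/orP; left; apply/eqP.
  by field; rewrite gt_eqF.
rewrite ler_pdivrMr// -!mulrA.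
have -> : d * (h^-1 * ((c x * expR (th * x))^-1 * (expR (`|x| * h) * h))) =
    d * expR (`|x| * h) / (c x * expR (th * x)).
  by field; rewrite !gt_eqF ?expR_gt0.
by rewrite ler_pdivlMr// mulrC -ler_pdivrMr// mulrAC.
Unshelve. all: by end_near. Qed.

(** Where [c x > 0], uniqueness of the limit in [density_cvg], taken at x and at a fixed [x0], shows
    that W x / (c x e^(th x)) is a constant n. Where [c x = 0], both sides vanish because [nu] does
    not charge ]-oo, x]. The constant N is 1 / n. *)
Lemma weighted_exponential th : laplace_interior nu th ->
  exists k N, 0 < N /\ forall x,
    c x * expR (th * x) = N * \int[nu]_(t in `]-oo, x]) ((k - t) * expR (th * t)).
Proof.
move=> Hth; exists (mean th).
have L0 := exp_integralT_gt0 nu_not_point Hth.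
have [x0 x00] := exists_left_ray_neq0 nu_not_point.
have cx0 : 0 < c x0 by rewrite lt_neqAle weight_ge0 andbT eq_sym weight_eq0.
set W := fun x => \int[nu]_(t in `]-oo, x]) ((mean th - t) * expR (th * t)).
pose n := W x0 / (c x0 * expR (th * x0)).
have nE x : n * (c x * expR (th * x)) = W x.
  have := weight_ge0 x; rewrite le_eqVlt => /predU1P[/esym cx|cx].
    have nu0 : nu `]-oo, x]%classic = 0%E by apply/eqP; rewrite -weight_eq0 cx.
    rewrite cx mul0r mulr0.
    rewrite /W /Rintegral null_set_integral//.
    by apply: (measurable_int nu); exact: centered_moment_integrable.
  have [e1 e2] : c x * expR (th * x) != 0 /\ c x0 * expR (th * x0) != 0.
    by rewrite !gt_eqF// mulr_gt0// expR_gt0.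
  have /(cvg_unique (@norm_hausdorff _ _)) := density_cvg cx0 Hth.
  move=> /(_ _ (density_cvg cx Hth)).
  rewrite -/(W x) -/(W x0) => H.
  have {}H : W x0 / (c x0 * expR (th * x0)) = W x / (c x * expR (th * x)).
    have -> : W x0 / (c x0 * expR (th * x0)) =
      W x0 / exp_integral nu setT th / (c x0 * expR (th * x0)) * exp_integral nu setT th.
      by field; rewrite !gt_eqF ?expR_gt0.
    by rewrite H; field; rewrite !gt_eqF ?expR_gt0.
  by rewrite /n H divfK.
(* Up to a positive factor, n is a limit of ratios of masses of [mu] to lengths. *)
have n_ge0 : 0 <= n.
  have : 0 <= W x0 / exp_integral nu setT th / (c x0 * expR (th * x0)).
    apply: (closed_cvg _ (@closed_ge _ 0) _ _ (density_cvg cx0 Hth)).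
    near=> h; have h0 : 0 < h by near: h; exact: nbhs_right_gt.
    by rewrite /= divr_ge0 ?fine_ge0// ltW.
  by rewrite mulrAC pmulr_lge0 ?invr_gt0.
(* If n = 0 then W vanishes identically. Its value at the mean integrates a function that is
   positive left of the mean, so no mass lies there; as the total centered moment is zero too, no
   mass lies to the right either. *)
have n_neq0 : n != 0.
  apply/eqP => n0; apply: nu_not_point; exists (mean th).
  have W0 x : W x = 0 by rewrite -nE n0 mul0r.
  have iW A : measurable A -> nu.-integrable A
      (EFin \o (fun t : RT => (mean th - t) * expR (th * t))).
    by move=> mA; exact: centered_moment_integrable.
  have mW A : measurable_fun A (fun t : RT => (mean th - t) * expR (th * t)).
    apply: measurable_funM; last by apply: measurable_funTS; exact: measurable_expRM.
    exact: measurable_funB.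
  have WE A : measurable A ->
    (\int[nu]_(t in A) ((mean th - t) * expR (th * t)))%:E =
    (\int[nu]_(t in A) ((mean th - t) * expR (th * t))%:E)%E.
    by move=> mA; rewrite fineK//; apply: integrable_fin_num => //; exact: iW.
  have left0 : nu `]-oo, mean th[%classic = 0%E.
    apply: (@gt0_integral_eq0 _ _ _ nu _ (fun t => (mean th - t) * expR (th * t))) => //.
    - by move=> t /=; rewrite in_itv/= => tk; rewrite mulr_gt0 ?expR_gt0 ?subr_gt0.
    apply/eqP; rewrite eq_le; apply/andP; split.
      rewrite -[0%E]/(0%:E) -(W0 (mean th)) /W WE//.
      apply: ge0_subset_integral => //.
      - exact/measurable_EFinP.
      - move=> t /=; rewrite in_itv/= => tk.
        by rewrite lee_fin mulr_ge0 ?expR_ge0 ?subr_ge0.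
      - by move=> t /=; rewrite !in_itv/= => /ltW.
    apply: integral_ge0 => t /=; rewrite in_itv/= => tk.
    by rewrite lee_fin mulr_ge0 ?expR_ge0 ?subr_ge0// ltW.
  have right0 : nu `]mean th, +oo[%classic = 0%E.
    apply: (@gt0_integral_eq0 _ _ _ nu _ (fun t => - ((mean th - t) * expR (th * t)))) => //.
    - exact: measurable_funN.
    - move=> t /=; rewrite in_itv/= andbT => tk.
      by rewrite -mulNr opprB mulr_gt0 ?expR_gt0 ?subr_gt0.
    have T0 : \int[nu]_t ((mean th - t) * expR (th * t)) = 0.
      by rewrite centered_moment_integral// /mean divfK ?subrr// gt_eqF.
    have U : [set: RT] = `]-oo, mean th]%classic `|` `]mean th, +oo[%classic.
      apply/seteqP; split => // t _ /=; rewrite !in_itv/= andbT.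
      by have [] := leP t (mean th); [left|right].
    under eq_integral do rewrite EFinN.
    rewrite integralN; last by apply: integrable_add_def => //; exact: iW.
    rewrite -WE//.
    move: T0; rewrite U Rintegral_setU//.
    - by rewrite -/(W _) W0 add0r => ->; rewrite oppe0.
    - by rewrite -U; exact: iW.
    apply/disj_setPS => t [] /=; rewrite !in_itv/= andbT => a b.
    by move: b; rewrite ltNge a.
  have U0 : nu (`]-oo, mean th[%classic `|` `]mean th, +oo[%classic) = 0%E.
    by rewrite measureU0.
  apply: (subset_measure0 _ _ _ U0) => //.
  - exact: measurableC.
  - exact: measurableU.
  - by move=> t /= /eqP; rewrite !in_itv/= andbT neq_lt => /orP[]; [left|right].
exists n^-1; split; first by rewrite invr_gt0 lt_neqAle eq_sym n_neq0.
by move=> x; rewrite -/(W x) -nE mulKf.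
Unshelve. all: by end_near. Qed.

End tail_representation.

(** * First-order increments of the weight and of the generating measure *)

Section increments.
Context {R : realType}.
Notation RT := (measurableTypeR R).

Lemma Rintegral_near_cst d (T : measurableType d)
    (m : {measure set T -> \bar R}) (D : set T) (f : T -> R) (r b : R) :
  measurable D -> (m D < +oo)%E -> m.-integrable D (EFin \o f) ->
  (forall x, D x -> `|f x - r| <= b) ->
  `|\int[m]_(x in D) f x - r * fine (m D)| <= b * fine (m D).
Proof.
move=> mD Doo intf fb.
have icst (s : R) : m.-integrable D (EFin \o cst s).
  apply: measurable_bounded_integrable => //.
  by exists `|s|; split => // y /ltW ys x _.
have ifr : m.-integrable D (EFin \o (fun x => f x - r)).
  by have := integrableB mD intf (icst r); apply: eq_integrable.
rewrite -Rintegral_cst// -RintegralB//; last exact: icst.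
apply: (le_trans (le_normr_Rintegral mD ifr)).
rewrite -Rintegral_cst//; apply: le_Rintegral => //; last exact: icst.
exact: integrable_norm.
Qed.

Lemma is_derive_lipschitz (f : R -> R) (z l : R) : is_derive z (1 : R) f l ->
  exists2 d, 0 < d & forall t, `|t - z| < d ->
    `|f t - f z| <= (`|l| + 1) * `|t - z|.
Proof.
case=> /cvg_ex[/= l' cl] Dl.
have {}Dl : l' = l by rewrite -Dl; apply: esym; apply/cvg_lim.
move: cl; rewrite Dl => /cvgrPdist_le /(_ 1 ltr01).
move=> /nbhs_ballP[d /= d0 H]; exists d => // t td.
have [->|tz] := eqVneq t z; first by rewrite !subrr normr0 mulr0.
have tz0 : t - z != 0 by rewrite subr_eq0.
have := H (t - z); rewrite /ball/= sub0r normrN => /(_ td tz0).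
rewrite [(t - z) *: _]mulr1 subrK => h.
have h1 : `|(t - z)^-1 *: (f t - f z)| <= `|l| + 1.
  rewrite -[X in `|X|](subKr l); apply: (le_trans (ler_normB _ _)).
  by rewrite lerD2l.
move: h1; rewrite normrM normfV ler_pdivrMl ?normr_gt0// mulrC.
by [].
Qed.

(** From e^(-s) >= 1 - s one gets e^s (1 - s) <= 1, hence e^s - 1 - s <= s^2 / (1 - s), and 1 - s >=
    1/2. *)
Lemma expR_taylor1 (s : R) : `|s| <= 1 / 2 -> `|expR s - 1 - s| <= 2 * s ^+ 2.
Proof.
move=> s2; have h1 := expR_ge1Dx s; have h2 := expR_ge1Dx (- s).
have /andP[s2a s2b] : - (1 / 2) <= s <= 1 / 2 by rewrite -ler_norml.
have es : expR s * (1 - s) <= 1.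
  by rewrite -ler_pdivlMl ?expR_gt0// mulr1 -expRN.
have e0 := expR_gt0 s.
by rewrite ger0_norm; nra.
Qed.

End increments.

Section weighted_increments.
Context {R : realType} (nu : {measure set (measurableTypeR R) -> \bar R}).
Notation RT := (measurableTypeR R).
Variables (c : R -> R) (th k N : R).
Implicit Types (x y z t : R).
Hypothesis Hth : laplace_interior nu th.

Let phi t := (k - t) * expR (th * t).

Hypothesis weight_eq : forall x,
  c x * expR (th * x) = N * \int[nu]_(t in `]-oo, x]) phi t.

(** On a bounded interval e^(th t) is bounded below by a positive constant, so the finite
    exponential integral controls the mass. *)
Lemma nu_itv_lty x y : (nu `]x, y]%classic < +oo)%E.
Proof.
pose b := expR (- (`|th| * (`|x| + `|y|))).
have b0 : 0 < b by exact: expR_gt0.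
have : (b%:E * nu `]x, y]%classic <= (exp_integral nu `]x, y] th)%:E)%E.
  rewrite EFin_exp_integral// -integral_cst//; apply: ge0_le_integral => //.
  - by move=> t _; rewrite lee_fin ltW.
  - by apply/measurable_EFinP; apply: measurable_funTS; exact: measurable_expRM.
  - move=> t /=; rewrite in_itv/= => /andP[xt ty]; rewrite lee_fin ler_expR.
    rewrite lerNl -mulNr; apply: (le_trans (ler_norm _)); rewrite normrM normrN.
    rewrite ler_wpM2l// ler_norml.
    have := ler_norm (- x); have := ler_norm y; rewrite normrN.
    have : 0 <= `|x| by []. have : 0 <= `|y| by [].
    by move=> *; apply/andP; split; lra.
rewrite -lee_pdivlMl// => /le_lt_trans; apply.
by rewrite -EFinM ltry.
Qed.

Let disjoint_oc (b : itv_bound R) x y :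
  [disjoint ([set` Interval b (BRight x)] : set RT) & `]x, y]%classic].
Proof.
apply/disj_setPS => t [] /=; rewrite !itv_boundlr /= => /andP[_ a] /andP[b' _].
by move: a b'; rewrite !bnd_simp => a; rewrite ltNge a.
Qed.

Lemma weight_increment x y : x <= y ->
  c y * expR (th * y) - c x * expR (th * x) = N * \int[nu]_(t in `]x, y]) phi t.
Proof.
move=> xy; rewrite !weight_eq -mulrBr; congr (_ * _).
have -> : `]-oo, y]%classic = (`]-oo, x]%classic : set RT) `|` `]x, y]%classic.
  apply/seteqP; split => t /=; rewrite !in_itv/=.
    by move=> ty; have [] := leP t x; [left|right].
  by move=> [/le_trans|/andP[]//]; apply.
rewrite Rintegral_setU//; first by rewrite addrAC subrr add0r.
  by apply: centered_moment_integrable => //; exact: measurableU.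
Qed.

(** Left rays are not known to have finite mass, so the distribution function is counted from a base
    point. *)
Let G x0 y := fine (nu `]x0, y]%classic).

Lemma nu_increment x0 x y : x0 <= x -> x <= y ->
  G x0 y - G x0 x = fine (nu `]x, y]%classic).
Proof.
move=> x0x xy; rewrite /G.
have -> : `]x0, y]%classic = (`]x0, x]%classic : set RT) `|` `]x, y]%classic.
  apply/seteqP; split => t /=; rewrite !in_itv/=.
    by move=> /andP[-> ty]; have [] := leP t x; [left|right].
  move=> [/andP[-> /le_trans]|/andP[a ->]]; first by apply.
  by rewrite (le_lt_trans x0x a).
rewrite measureU//; last by apply/disj_set2P; exact: disjoint_oc.
by rewrite fineD ?ge0_fin_numE ?nu_itv_lty// addrAC subrr add0r.
Qed.

(** As [phi] is Lipschitz at z, its integral between z and y is phi(z) times the increment of [G],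
    up to M |y - z| |G y - G z|. Multiplying by e^(-th y) and expanding e^(-th (y - z)) to first
    order isolates [c y]. *)
Lemma weight_relation x0 z : x0 < z -> exists K, \forall y \near z,
  `|c y - c z + th * c z * (y - z) - N * (k - z) * (G x0 y - G x0 z)| <=
  K * `|y - z| * (`|c z| * `|y - z| + `|G x0 y - G x0 z|).
Proof.
move=> x0z.
have [M [d d0 Md]] : exists M, exists2 d, 0 < d & forall t, `|t - z| < d ->
    `|phi t - phi z| <= M * `|t - z|.
  have [l dl] : exists l, is_derive z (1 : R) phi l.
    by eexists; rewrite /phi; exact: is_deriveM.
  by have := is_derive_lipschitz dl; exists (`|l| + 1).
have M0 : 0 <= M.
  have : `|z + d / 2 - z| < d by rewrite addrC addKr gtr0_norm; lra.
  move/Md; move/(le_trans (normr_ge0 _)); rewrite pmulr_lge0//.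
  by rewrite addrC addKr gtr0_norm; lra.
(* With s = -th (y - z), the three terms bound c z (e^s - 1 - s), then N (k - z) (e^s - 1) times the
   increment of [G], then the Lipschitz remainder multiplied by N e^(-th y), where e^s <= 2. *)
exists (2 * th ^+ 2 + 2 * (`|N * (k - z)| * `|th|) +
  2 * (`|N| * expR (- (th * z)) * M)).
have t0 : 0 < 1 / (2 * (`|th| + 1)) by rewrite divr_gt0// mulr_gt0// ltr_wpDl.
near=> y.
have yd : `|y - z| < d by rewrite distrC; near: y; exact: nbhsx_ballx.
have yx0 : x0 < y by near: y; exact: lt_nbhsr.
have hth : `|th * (y - z)| <= 1 / 2.
  have : `|y - z| < 1 / (2 * (`|th| + 1)).
    by rewrite distrC; near: y; exact: nbhsx_ballx.
  rewrite ltr_pdivlMr ?mulr_gt0 ?ltr_wpDl// normrM.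
  have : 0 <= `|th| by []. have : 0 <= `|y - z| by [].
  set u := `|y - z|; set v := `|th|; move=> *; nra.
set D := G x0 y - G x0 z.
have : exists2 r, `|r| <= M * `|y - z| * `|D| &
  c y * expR (th * y) - c z * expR (th * z) = N * (phi z * D + r).
  have [zy|yz] := leP z y.
    exists (\int[nu]_(t in `]z, y]) phi t - phi z * D); last first.
      by rewrite weight_increment// addrC subrK.
    have DV : D = fine (nu `]z, y]%classic) by exact: nu_increment (ltW x0z) zy.
    have D0 : 0 <= D by rewrite DV fine_ge0.
    rewrite (ger0_norm D0) DV.
    apply: Rintegral_near_cst => //; first exact: nu_itv_lty.
      exact: centered_moment_integrable.
    move=> t /=; rewrite in_itv/= => /andP[zt ty].
    have tyz : `|t - z| <= `|y - z|.
      by rewrite !ger0_norm ?subr_ge0 ?lerB// ltW.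
    apply: (le_trans (Md _ (le_lt_trans tyz yd))).
    by rewrite ler_wpM2l.
  (* To the left of z both increments change sign, and so does the remainder. *)
  exists (- (\int[nu]_(t in `]y, z]) phi t - phi z * - D)); last first.
    rewrite -[LHS]opprB weight_increment ?ltW//; ring.
  have DV : - D = fine (nu `]y, z]%classic).
    by rewrite opprB; exact: nu_increment (ltW yx0) (ltW yz).
  have D0 : 0 <= - D by rewrite DV fine_ge0.
  rewrite normrN -(normrN D) (ger0_norm D0) DV.
  apply: Rintegral_near_cst => //; first exact: nu_itv_lty.
    exact: centered_moment_integrable.
  move=> t /=; rewrite in_itv/= => /andP[yt tz].
  have tyz : `|t - z| <= `|y - z|.
    by rewrite !ler0_norm ?subr_le0 ?lerN2 ?lerB// ltW.
  apply: (le_trans (Md _ (le_lt_trans tyz yd))).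
  by rewrite ler_wpM2l.
move=> [r rM cyz].
pose s := - (th * (y - z)).
have s2 : `|s| <= 1 / 2 by rewrite normrN.
have Ts := expR_taylor1 s2.
have ey : expR (- (th * y)) = expR (- (th * z)) * expR s.
  by rewrite -expRD; congr expR; rewrite /s; ring.
have eyz : expR (th * z) * expR (- (th * y)) = expR s.
  by rewrite -expRD; congr expR; rewrite /s; ring.
have cyE : c y = c z * expR s + N * (phi z * D + r) * expR (- (th * y)).
  rewrite -cyz mulrBl -!mulrA eyz -expRD subrr expR0; ring.
have e2 : expR s <= 2.
  have : 0 <= s ^+ 2 by exact: sqr_ge0.
  move: Ts s2; rewrite !ler_norml => /andP[_ a] /andP[b b'] _.
  by nra.
have u1 : `|expR s - 1| <= 2 * `|s|.
  have -> : expR s - 1 = (expR s - 1 - s) + s by ring.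
  apply: (le_trans (ler_normD _ _)).
  have : 2 * s ^+ 2 <= `|s|.
    rewrite -real_normK ?num_real// expr2 mulrA -[leRHS]mul1r ler_wpM2r//.
    by lra.
  by move: Ts; lra.
have -> : c y - c z + th * c z * (y - z) - N * (k - z) * D =
  c z * (expR s - 1 - s) + N * (k - z) * (expR s - 1) * D +
  N * expR (- (th * y)) * r.
  have -> : c y = c z * expR s + (N * (k - z) * D * expR s +
      N * expR (- (th * y)) * r).
    by rewrite cyE -eyz /phi; ring.
  by rewrite /s; ring.
apply: (le_trans (ler_normD _ _)).
apply: (@le_trans _ _ ((2 * th ^+ 2 * `|y - z| * (`|c z| * `|y - z|) +
  2 * (`|N * (k - z)| * `|th|) * `|y - z| * `|D|) +
  2 * (`|N| * expR (- (th * z)) * M) * `|y - z| * `|D|)); last first.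
  have : 0 <= th ^+ 2 by exact: sqr_ge0.
  have : 0 <= `|N * (k - z)| * `|th| by rewrite mulr_ge0.
  have : 0 <= `|N| * expR (- (th * z)) * M by rewrite !mulr_ge0// expR_ge0.
  have : 0 <= `|y - z| by []. have : 0 <= `|D| by [].
  have : 0 <= `|c z| * `|y - z| by rewrite mulr_ge0.
  set a1 := `|c z| * `|y - z|; set a2 := `|D|; set a3 := `|y - z|.
  set a4 := `|N| * _ * _; set a5 := `|N * _| * _; set a6 := th ^+ 2.
  move=> h1 h2 h3 h4 h5 h6.
  rewrite -subr_ge0.
  suff : 0 <= a3 * ((2 * a5 + 2 * a4) * a1 + 2 * a6 * a2).
    by move=> /le_trans; apply; rewrite le_eqVlt; apply/orP; left; apply/eqP; ring.
  by rewrite mulr_ge0// addr_ge0// mulr_ge0// ?addr_ge0// mulr_ge0.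
apply: lerD.
  apply: (le_trans (ler_normD _ _)); apply: lerD.
    rewrite normrM mulrC.
    have -> : 2 * th ^+ 2 * `|y - z| * (`|c z| * `|y - z|) =
      2 * s ^+ 2 * `|c z|.
      by rewrite /s sqrrN exprMn -(real_normK (num_real (y - z))); ring.
    by rewrite ler_wpM2r.
  rewrite !normrM ler_wpM2r//.
  have -> : 2 * (`|N| * `|k - z| * `|th|) * `|y - z| = `|N| * `|k - z| * (2 * `|s|).
    by rewrite /s normrN normrM; ring.
  by rewrite ler_wpM2l ?mulr_ge0.
rewrite !normrM [`|expR _|]ger0_norm ?expR_ge0// ey.
apply: (@le_trans _ _ (`|N| * (expR (- (th * z)) * 2) * (M * `|y - z| * `|D|))).
  apply: ler_pM => //.
  by rewrite ler_wpM2l// ler_wpM2l ?expR_ge0.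
by rewrite le_eqVlt; apply/orP; left; apply/eqP; ring.
Unshelve. all: by end_near. Qed.

End weighted_increments.

(** * The weight function and the density of the generating measure *)

Section calculus.
Context {R : realType}.
Implicit Types (f : R -> R) (x y z t l : R).

Lemma is_derive_ge0 f z l : is_derive z (1 : R) f l ->
  (forall y, z <= y -> f z <= f y) -> 0 <= l.
Proof.
case=> /cvg_ex[/= l' cl] Dl fz.
have {}Dl : l' = l by rewrite -Dl; apply: esym; apply/cvg_lim.
rewrite -Dl; apply: (closed_cvg _ (@closed_ge _ 0) _ _ (cvg_dnbhs_at_right cl)).
near=> h; have h0 : 0 < h by near: h; exact: nbhs_right_gt.
rewrite /= [h *: _]mulr1 /GRing.scale/= mulr_ge0 ?invr_ge0 ?(ltW h0)//.
by rewrite subr_ge0 fz// lerDr ltW.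
Unshelve. all: by end_near. Qed.

(** The up-closed set [P] covers both the whole line and an open half-line. The product of f and
    e^(-Q) has derivative zero on it. *)
Lemma linear_ode (P : set R) (f q Q : R -> R) :
  (forall x y, P x -> x <= y -> P y) ->
  (forall z, P z -> is_derive z (1 : R) f (q z * f z)) ->
  (forall z, P z -> is_derive z (1 : R) Q (q z)) ->
  exists C, forall z, P z -> f z = C * expR (Q z).
Proof.
move=> Pup df dQ; pose g z := f z * expR (- Q z).
have dg z : P z -> is_derive z (1 : R) g 0.
  move=> Pz; have dE : is_derive z (1 : R) (fun u => expR (- Q u)) (expR (- Q z) * - q z).
    exact: (is_derive1_comp (is_derive_expR _) (is_deriveN (dQ _ Pz))).
  have := is_deriveM (df _ Pz) dE; move/is_derive_eq; apply.
  by rewrite /GRing.scale/=; ring.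
have gc x y : P x -> x <= y -> g x = g y.
  move=> Px xy.
  have [||c _] := @MVT_segment R g (fun=> 0) x y xy.
  - by move=> z; rewrite in_itv/= => /andP[/ltW xz _]; apply: dg; exact: Pup xz.
  - apply: derivable_within_continuous => z; rewrite in_itv/= => /andP[xz _].
    by have [] := dg z (Pup _ _ Px xz).
  by rewrite mul0r => /eqP; rewrite subr_eq0 => /eqP.
have [[x0 Px0]|P0] := pselect (exists x, P x); last first.
  by exists 0 => z Pz; exfalso; apply: P0; exists z.
exists (g x0) => z Pz.
have -> : g x0 = g z.
  by have [x0z|/ltW zx0] := leP x0 z; [exact: gc|apply: esym; exact: gc].
by rewrite /g -mulrA -expRD addNr expR0 mulr1.
Qed.

Lemma FTC2_increment (g F : R -> R) x y : x <= y ->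
  (forall z, x <= z <= y -> is_derive z (1 : R) F (g z)) ->
  {within `[x, y], continuous g} ->
  (\int[lebesgue_measure]_(z in `]x, y]) (g z)%:E = (F y - F x)%:E)%E.
Proof.
rewrite le_eqVlt => /predU1P[->|xy] dF cg.
  by rewrite set_itv_ge ?bnd_simp ?ltxx// integral_set0 subrr.
have cF z : x <= z <= y -> F u @[u --> z] --> F z.
  by move=> /dF[/derivable1_diffP/differentiable_continuous].
rewrite integral_itv_obnd_cbnd; last first.
  have mg := subspace_continuous_measurable_fun (measurable_itv `[x, y]) cg.
  apply/measurable_EFinP; apply: (measurable_funS (measurable_itv `[x, y]) _ mg).
  by move=> z /=; rewrite !in_itv/= => /andP[/ltW -> ->].
rewrite (continuous_FTC2 (F := F) xy cg)//.
  split.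
  - by move=> z; rewrite in_itv/= => /andP[/ltW a /ltW b]; have [] := dF z; rewrite ?a.
  - by apply: cvg_at_right_filter; apply: cF; rewrite lexx ltW.
  - by apply: cvg_at_left_filter; apply: cF; rewrite lexx ltW.
move=> z; rewrite in_itv/= => /andP[/ltW a /ltW b]; rewrite derive1E.
by have [] := dF z; rewrite ?a.
Qed.

End calculus.

Section two_tilts.
Context {R : realType} (nu : {measure set (measurableTypeR R) -> \bar R}).
Notation RT := (measurableTypeR R).
Variables (c : R -> R) (th1 th2 k1 k2 N1 N2 : R).
Implicit Types (x y z t : R).
Hypothesis th12 : th1 != th2.
Hypotheses (Hth1 : laplace_interior nu th1) (Hth2 : laplace_interior nu th2).
Hypothesis N1_gt0 : 0 < N1.
Let weight_eq th k N := forall x,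
  c x * expR (th * x) = N * \int[nu]_(t in `]-oo, x]) ((k - t) * expR (th * t)).
Hypothesis weight1 : weight_eq th1 k1 N1.
Hypothesis weight2 : weight_eq th2 k2 N2.
Hypothesis c_ge0 : forall x, 0 <= c x.
Hypothesis c_eq0 : forall x, (c x == 0) = (nu `]-oo, x]%classic == 0%E).
Hypothesis c_neq0 : exists x, 0 < c x.

Let G x0 y := fine (nu `]x0, y]%classic).

(* The affine function a with c dx = a nu(dx). *)
Definition slope z := (N2 * (k2 - z) - N1 * (k1 - z)) / (th2 - th1).

Let relation x0 z : x0 < z -> exists K,
  (\forall y \near z,
    `|c y - c z + th1 * c z * (y - z) - N1 * (k1 - z) * (G x0 y - G x0 z)| <=
    K * `|y - z| * (`|c z| * `|y - z| + `|G x0 y - G x0 z|)) /\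
  (\forall y \near z,
    `|c y - c z + th2 * c z * (y - z) - N2 * (k2 - z) * (G x0 y - G x0 z)| <=
    K * `|y - z| * (`|c z| * `|y - z| + `|G x0 y - G x0 z|)).
Proof.
move=> x0z.
have [K1 H1] := weight_relation Hth1 weight1 x0z.
have [K2 H2] := weight_relation Hth2 weight2 x0z.
exists (`|K1| + `|K2|); split.
  apply: filterS H1 => y /le_trans; apply; rewrite -!mulrA ler_wpM2r//.
  by rewrite (le_trans (ler_norm _))// lerDl.
apply: filterS H2 => y /le_trans; apply; rewrite -!mulrA ler_wpM2r//.
by rewrite (le_trans (ler_norm _))// lerDr.
Qed.

(** Right-continuity in the weak form asked by [slope_neq0]: continuity from above along the
    intervals ]z, z + 1/(n+1)]. *)
Let G_right z e : 0 < e -> exists2 y, z < y < z + e & `|G (z - 1) y - G (z - 1) z| < e.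
Proof.
move=> e0.
have z1 : z - 1 <= z by rewrite gerBl.
have := @nonincreasing_cvg_mu _ _ _ nu (fun n : nat => `]z, z + n.+1%:R^-1]%classic : set RT).
have -> : \bigcap_n (`]z, z + n.+1%:R^-1]%classic : set RT) = set0.
  apply/seteqP; split => // x H.
  have zx : z < x by have := H 0%N I; rewrite /= in_itv/= => /andP[].
  have := H (Num.truncn (x - z)^-1) I; rewrite /= in_itv/= => /andP[_].
  rewrite -lerBlDl leNgt => /negP; apply.
  by rewrite invf_plt ?posrE ?subr_gt0// truncnS_gt.
rewrite measure0 => H.
have /fine_cvgP[_] : (nu \o (fun n : nat => `]z, z + n.+1%:R^-1]%classic : set RT)) n
    @[n --> \oo] --> 0%:E.
  apply: H => //; first exact: (nu_itv_lty Hth1).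
  move=> n m nm; apply/subsetPset => x /=; rewrite !in_itv/= => /andP[-> /le_trans].
  by apply; rewrite lerD2l lef_pV2 ?posrE// ler_nat.
move=> /cvgrPdist_lt /(_ e e0) H1.
have H2 : \forall n \near \oo, n.+1%:R^-1 < e.
  near=> n; rewrite invf_plt ?posrE//; apply: (lt_le_trans (truncnS_gt _)).
  by rewrite ler_nat ltnS; near: n; exact: nbhs_infty_ge.
near \oo => n.
have n0 : 0 < n.+1%:R^-1 :> R by rewrite invr_gt0.
exists (z + n.+1%:R^-1).
  by rewrite ltrDl n0 ltrD2l; near: n.
rewrite (nu_increment Hth1)// ?lerDl ?ltW//.
by rewrite -normrN -sub0r; near: n.
Unshelve. all: by end_near. Qed.

Lemma slope_neq0_at z : 0 < c z -> slope z != 0.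
Proof.
move=> cz; have zz : z - 1 < z by rewrite gtrBl.
have [K [H1 H2]] := relation zz.
apply: (slope_neq0 th12 H1 H2); first by rewrite gt_eqF.
exact: G_right.
Qed.

Lemma G_is_derive x0 z : x0 < z -> 0 < c z ->
  is_derive z (1 : R) (G x0) (c z / slope z).
Proof.
move=> x0z cz; have [K [H1 H2]] := relation x0z.
exact: (increment_derive th12 H1 H2 (slope_neq0_at cz)).
Qed.

(** The quotient [c z / slope z] is the derivative of a nondecreasing function, which fixes the
    sign. *)
Lemma slope_gt0 z : 0 < c z -> 0 < slope z.
Proof.
move=> cz; have zz : z - 1 < z by rewrite gtrBl.
rewrite lt_neqAle eq_sym slope_neq0_at//=.
have : 0 <= c z / slope z.
  apply: (is_derive_ge0 (G_is_derive zz cz)) => y zy.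
  by rewrite -subr_ge0 (nu_increment Hth1) ?fine_ge0// ltW.
by rewrite pmulr_rge0// invr_ge0.
Qed.

Lemma c_is_derive z : 0 < c z ->
  is_derive z (1 : R) c ((N1 * (k1 - z) / slope z - th1) * c z).
Proof.
move=> cz; have zz : z - 1 < z by rewrite gtrBl.
have [K [H1 H2]] := relation zz.
exact: (relation_derive th12 H1 H2 (slope_neq0_at cz)).
Qed.

Lemma c_up x y : x <= y -> 0 < c x -> 0 < c y.
Proof.
move=> xy; rewrite !lt_neqAle !c_ge0 !andbT ![_ == c _]eq_sym !c_eq0.
apply: contra => /eqP y0; apply/eqP; apply: (subset_measure0 _ _ _ y0) => //.
by move=> t /=; rewrite !in_itv/= => /le_trans; apply.
Qed.

(** Positivity of [c] propagates to the right by [c_up], so the threshold t is the supremum of the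
    zeros of [c]. *)
Lemma c_support : (forall x, 0 < c x) \/ exists t, forall x, (0 < c x) = (t < x).
Proof.
have [H|/existsNP[s /negP cs]] := pselect (forall x, 0 < c x); [by left|right].
have {}cs : c s = 0 by apply/eqP; rewrite eq_le c_ge0 andbT leNgt.
have [b cb] := c_neq0.
pose S := [set x | c x = 0].
have Sb : ubound S b.
  move=> x /= cx; rewrite leNgt; apply/negP => bx.
  by have := c_up (ltW bx) cb; rewrite cx ltxx.
have hS : has_sup S by split; [exists s|exists b].
have lo x : x < sup S -> c x = 0.
  move=> xS; have : 0 < sup S - x by rewrite subr_gt0.
  move=> /(sup_adherent)/(_ hS)[y Sy]; rewrite subKr => xy.
  apply/eqP; rewrite eq_le c_ge0 andbT leNgt; apply/negP => /(c_up (ltW xy)).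
  by rewrite Sy ltxx.
exists (sup S) => x; apply/idP/idP => [cx|Sx]; last first.
  rewrite lt_neqAle c_ge0 andbT eq_sym; apply/eqP => cx.
  have := ub_le_sup (ex_intro _ b Sb) cx.
  by rewrite leNgt Sx.
rewrite ltNge; apply/negP => xS.
(* A positive value gives differentiability, hence continuity, hence positive values slightly to the
   left; this excludes [0 < c x] when [x <= sup S]. *)
have : c u @[u --> x] --> c x.
  by have [/derivable1_diffP/differentiable_continuous] := c_is_derive cx.
move=> /cvgr_gt /(_ 0 cx) /nbhs_ballP[e /= e0 H].
have : 0 < c (x - e / 2).
  apply: H; rewrite /ball/= opprB addrC subrK gtr0_norm; lra.
by rewrite lo ?ltxx//; lra.
Qed.

(** [G_is_derive] holds at every point of [x, y], and the derivative is continuous there since [c]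
    and [slope] are differentiable and [slope] does not vanish. *)
Lemma density_itv x y : x <= y -> 0 < c x ->
  nu `]x, y]%classic = (\int[lebesgue_measure]_(z in `]x, y]) (c z / slope z)%:E)%E.
Proof.
move=> xy cx.
have x1 : x - 1 < x by rewrite gtrBl.
have cz z : x <= z -> 0 < c z by move=> /c_up; apply.
have dG z : x <= z <= y -> is_derive z (1 : R) (G (x - 1)) (c z / slope z).
  by move=> /andP[xz zy]; apply: G_is_derive; [exact: lt_le_trans xz|exact: cz].
have cg : {within `[x, y], continuous (fun z => c z / slope z)}.
  apply: derivable_within_continuous => z; rewrite in_itv/= => /andP[/cz z0 _].
  apply: derivableM; first by have [] := c_is_derive z0.
  by apply: derivableV; [exact: slope_neq0_at|].
rewrite (FTC2_increment xy dG cg) (nu_increment Hth1) ?(ltW x1)//.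
by rewrite fineK// ge0_fin_numE// (nu_itv_lty Hth1).
Qed.

Let slope_affine z : slope z * (th2 - th1) = (N2 * k2 - N1 * k1) + (N1 - N2) * z.
Proof. by rewrite divfK ?subr_eq0 1?eq_sym//; ring. Qed.

Lemma full_support : (forall x, 0 < c x) -> exists C A b,
  [/\ 0 < C, 0 < A, forall x, slope x = A &
    forall x, c x = C * expR (b * x - N1 / A * (x ^+ 2 / 2))].
Proof.
move=> cgt0.
have N12 : N1 = N2.
  apply/eqP/negPn/negP => N12.
  have N120 : N1 - N2 != 0 by rewrite subr_eq0.
  (* If N1 and N2 differed, [slope] would vanish at this point. *)
  have := slope_neq0_at (cgt0 (- (N2 * k2 - N1 * k1) / (N1 - N2))).
  move/eqP; apply; apply: (@mulIf _ (th2 - th1)); first by rewrite subr_eq0 eq_sym.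
  by rewrite slope_affine mul0r; field.
have sE x : slope x = slope 0.
  apply: (@mulIf _ (th2 - th1)); first by rewrite subr_eq0 eq_sym.
  by rewrite !slope_affine N12 subrr !mul0r.
pose A := slope 0; pose b := N1 * k1 / A - th1.
have A0 : 0 < A by exact: slope_gt0.
pose Q x := b * x - N1 / A * (x ^+ 2 / 2).
pose q x := N1 * (k1 - x) / A - th1.
have [|||C HC] := @linear_ode R setT c q Q.
- by [].
- by move=> z _; rewrite /q /A -(sE z); exact: c_is_derive.
- move=> z _; apply: (@quadratic_is_derive _ _ _ _ (N1 / A / 2)).
  near=> y; rewrite (real_normK (num_real (y - z))).
  have -> : Q y - Q z - q z * (y - z) = - (N1 / A / 2 * (y - z) ^+ 2).
    by rewrite /Q /q /b; field; rewrite gt_eqF.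
  have NA : 0 <= N1 / A / 2 by apply/ltW/divr_gt0 => //; exact: divr_gt0.
  by rewrite normrN ger0_norm// mulr_ge0// sqr_ge0.
exists C, A, b; split => // [|x]; last exact: HC.
by have := cgt0 0; rewrite HC// pmulr_lgt0 ?expR_gt0.
Unshelve. all: by end_near. Qed.

(** If k1 <= t, the integrand (k1 - s) e^(th1 s) is nonpositive on ]t, x], whereas its integral has
    the sign of c(x) > 0. The conclusion makes the shape parameter positive. *)
Let weight_nonpos t x : (forall z, (0 < c z) = (t < z)) -> t < x -> t < k1.
Proof.
move=> ct tx; rewrite ltNge; apply/negP => k1t.
have cx : 0 < c x by rewrite ct.
have c0 : c t = 0 by apply/eqP; rewrite eq_le c_ge0 andbT leNgt ct ltxx.
have := weight_increment Hth1 weight1 (ltW tx); rewrite c0 mul0r subr0 => E.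
have : 0 < c x * expR (th1 * x) by rewrite mulr_gt0// expR_gt0.
rewrite E pmulr_rgt0// ltNge => /negP; apply.
rewrite -[leRHS](mul0r (fine (nu `]t, x]%classic))) -Rintegral_cst//.
apply: le_Rintegral => //.
- exact: centered_moment_integrable.
- apply: measurable_bounded_integrable => //; first exact: (nu_itv_lty Hth1).
  by exists 0; split => // y y0 s _; rewrite /= normr0 ltW.
- move=> s /=; rewrite in_itv/= => /andP[ts _].
  rewrite mulr_le0_ge0 ?expR_ge0// subr_le0.
  by rewrite (le_trans k1t)// ltW.
Qed.

Lemma half_line_support t : (forall x, (0 < c x) = (t < x)) ->
  exists C B th0 p, [/\ [/\ 0 < C, 0 < B, 0 < p & th1 < th0],
    forall x, slope x = B * (x - t) &
    forall x, t < x -> c x = C * expR (p * ln (x - t) - th0 * x)].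
Proof.
move=> ct.
have d0 : th2 - th1 != 0 by rewrite subr_eq0 eq_sym.
have c0 : c t = 0 by apply/eqP; rewrite eq_le c_ge0 andbT leNgt ct ltxx.
(* Otherwise [increment_cst] applies at t, where [c] vanishes: [nu] has no mass just right of t, so
   [c] would still vanish there. *)
have st : slope t = 0.
  apply/eqP/negPn/negP => st.
  have t1 : t - 1 < t by rewrite gtrBl.
  have [K [H1 H2]] := relation t1.
  have /nbhs_ballP[e /= e0 He] := increment_cst th12 H1 H2 st c0.
  have te : t < t + e / 2 by rewrite ltrDl divr_gt0.
  have : G (t - 1) (t + e / 2) - G (t - 1) t = 0.
    apply/eqP; rewrite subr_eq0; apply/eqP; apply: He.
    by rewrite /ball/= opprD addNKr normrN gtr0_norm; lra.
  rewrite (nu_increment Hth1) ?ltW// => /eqP.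
  rewrite fine_eq0 ?ge0_fin_numE ?(nu_itv_lty Hth1)// => /eqP nu0.
  have : c (t + e / 2) == 0.
    rewrite c_eq0.
    have -> : `]-oo, t + e / 2]%classic = (`]-oo, t]%classic : set RT) `|`
        `]t, t + e / 2]%classic.
      apply/seteqP; split => s /=; rewrite !in_itv/=.
        by move=> sb; have [] := leP s t; [left|right].
      by move=> [/le_trans|/andP[]//]; apply; exact: ltW.
    apply/eqP; rewrite measureU0//; apply/eqP.
    by rewrite -c_eq0 c0.
  by rewrite gt_eqF// ct.
pose B := (N1 - N2) / (th2 - th1).
have sE x : slope x = B * (x - t).
  apply: (mulIf d0); rewrite slope_affine.
  have := slope_affine t; rewrite st mul0r => /esym/eqP.
  rewrite addr_eq0 => /eqP ->; rewrite /B; field.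
  by [].
have B0 : 0 < B.
  have : 0 < slope (t + 1) by apply: slope_gt0; rewrite ct ltrDl.
  by rewrite sE addrC addKr mulr1.
(* These come from the partial fractions of c'/c = N1 (k1 - x) / (B (x - t)) - th1 = p / (x - t) -
   th0. *)
pose th0 := N1 / B + th1; pose p := N1 * (k1 - t) / B.
pose Q x := p * ln (x - t) - th0 * x.
pose q x := N1 * (k1 - x) / (B * (x - t)) - th1.
have [|||C HC] := @linear_ode R [set x | t < x] c q Q.
- by move=> x y /= /lt_le_trans; apply.
- by move=> z /= tz; rewrite /q -sE; apply: c_is_derive; rewrite ct.
- move=> z /= tz.
  have tz0 : 0 < z - t by rewrite subr_gt0.
  have lin (a b : R) : is_derive z (1 : R) (fun x => a * x + b) a.
    apply: (@quadratic_is_derive _ _ _ _ 0); near=> y.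
    have -> : a * y + b - (a * z + b) - a * (y - z) = 0 by ring.
    by rewrite normr0 mul0r.
  have dln : is_derive z (1 : R) (fun x => ln (x - t)) (z - t)^-1.
    have l1 := lin 1 (- t).
    have -> : (fun x => ln (x - t)) = (@ln R) \o (fun x => 1 * x - t).
      by apply/funext => x /=; rewrite mul1r.
    rewrite -[_^-1]mulr1; apply: is_derive1_comp l1; rewrite mul1r.
    exact: is_derive1_ln.
  have -> : Q = p \*: (fun x => ln (x - t)) - (fun x => th0 * x + 0).
    by apply/funext => x; rewrite /Q !fctE addr0.
  have := is_deriveB (is_deriveZ p dln) (lin th0 0); move/is_derive_eq; apply.
  rewrite /GRing.scale/= /q /p /th0; field.
  by rewrite !gt_eqF.
exists C, B, th0, p; split => //; split => //.
- have : 0 < c (t + 1) by rewrite ct ltrDl.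
  by rewrite HC ?pmulr_lgt0 ?expR_gt0//= ltrDl.
- rewrite /p divr_gt0// mulr_gt0// subr_gt0.
  by apply: (weight_nonpos ct (x := t + 1)); rewrite ltrDl.
- by rewrite /th0 ltrDr divr_gt0.
Unshelve. all: by end_near. Qed.

End two_tilts.

(** * Measures with a density *)

Section density.
Context d (T : measurableType d) (R : realType).
Variables (m : {measure set T -> \bar R}) (g : T -> R).
Hypothesis g_ge0 : forall x, 0 <= g x.
Hypothesis mg : measurable_fun setT g.

Definition density : set T -> \bar R := fun A => (\int[m]_(x in A) (g x)%:E)%E.

Let density0 : density set0 = 0%E. Proof. exact: integral_set0. Qed.

Let density_ge0 A : (0 <= density A)%E.
Proof. by apply: integral_ge0 => x _; rewrite lee_fin. Qed.

Let density_sigma_additive : semi_sigma_additive density.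
Proof.
move=> F mF tF mUF; rewrite /density ge0_integral_bigcup//.
- apply: is_cvg_ereal_nneg_natsum_cond => n _ _.
  exact: density_ge0.
- by apply/measurable_EFinP; exact: measurable_funTS.
- by move=> x _; rewrite lee_fin.
Qed.

HB.instance Definition _ := isMeasure.Build _ _ _
  density density0 density_ge0 density_sigma_additive.

Definition density_measure : {measure set T -> \bar R} := density.

Import HBNNSimple.

(** Agreement with [density] is asked on measurable sets only, as measures are unconstrained
    elsewhere. Simple functions reduce the claim to indicators, and monotone convergence does the
    rest. *)
Lemma ge0_integral_density (nu : {measure set T -> \bar R}) D (f : T -> \bar R) :
  (forall A, measurable A -> nu A = density A) ->
  measurable D -> measurable_fun D f -> (forall x, D x -> (0 <= f x)%E) ->
  (\int[nu]_(x in D) f x = \int[m]_(x in D) (f x * (g x)%:E))%E.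
Proof.
move=> nuE mD mf f0.
have mgD : measurable_fun D (fun x => (g x)%:E).
  by apply/measurable_EFinP; exact: measurable_funTS.
pose f_ := nnsfun_approx mD mf.
have cvf x : D x -> (f_ n x)%:E @[n --> \oo] --> f x.
  by move=> Dx; apply: cvg_nnsfun_approx => // y Dy; exact: f0.
have mfn n : measurable_fun D (fun x => (f_ n x)%:E).
  by apply/measurable_EFinP; exact: measurable_funTS.
transitivity (limn (fun n => (\int[nu]_(x in D) (f_ n x)%:E)%E)).
  rewrite -monotone_convergence//.
  - by apply: eq_integral => x /[!inE] Dx; apply/esym/cvg_lim => //; exact: cvf.
  - by move=> n x _; rewrite lee_fin.
  - by move=> x _ a b ab; rewrite lee_fin; exact/lefP/nd_nnsfun_approx.
transitivity (limn (fun n => (\int[m]_(x in D) ((f_ n x)%:E * (g x)%:E))%E)); last first.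
  rewrite -monotone_convergence//.
  - apply: eq_integral => x /[!inE] Dx; apply/cvg_lim => //.
    by apply: cvgeZr => //; exact: cvf.
  - by move=> n; apply: emeasurable_funM.
  - by move=> n x _; rewrite mule_ge0// lee_fin.
  - move=> x _ a b ab; rewrite lee_wpmul2r ?lee_fin//.
    exact/lefP/nd_nnsfun_approx.
congr (limn _); apply/funext => n.
have mfk k : measurable (f_ n @^-1` [set k]).
  exact: measurable_sfunP.
transitivity (\sum_(k \in range (f_ n))
    (\int[nu]_(x in D) (k * \1_(f_ n @^-1` [set k]) x)%:E)%E)%E.
  rewrite -ge0_integral_fsum//.
  - by apply: eq_integral => x _; rewrite fimfunE -fsumEFin.
  - by move=> k; apply/measurable_EFinP/measurable_funM => //; exact: measurable_funTS.
  - by move=> k x _; rewrite nnfun_muleindic_ge0.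
transitivity (\sum_(k \in range (f_ n))
    (\int[m]_(x in D) ((k * \1_(f_ n @^-1` [set k]) x)%:E * (g x)%:E))%E)%E; last first.
  rewrite -ge0_integral_fsum//.
  - apply: eq_integral => x _; rewrite -ge0_mule_fsuml//.
      by rewrite fsumEFin// -fimfunE.
    by move=> k; rewrite nnfun_muleindic_ge0.
  - move=> k; apply: emeasurable_funM => //.
    by apply/measurable_EFinP/measurable_funM => //; exact: measurable_funTS.
  - by move=> k x _; rewrite mule_ge0 ?nnfun_muleindic_ge0 ?lee_fin.
apply: eq_fsbigr => k /[!inE] -[y _ <-].
have fy0 : (0 <= (f_ n y)%:E)%E by rewrite lee_fin.
set B := f_ n @^-1` _.
under eq_integral do rewrite EFinM.
rewrite ge0_integralZl_EFin//; last first.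
  by apply/measurable_EFinP/measurable_funTS/measurable_indic; exact: mfk.
under [RHS]eq_integral do rewrite EFinM -muleA.
rewrite ge0_integralZl_EFin//; last 2 first.
- by move=> x _; rewrite mule_ge0// lee_fin.
- apply: emeasurable_funM => //.
  by apply/measurable_EFinP/measurable_funTS/measurable_indic; exact: mfk.
congr (_ * _)%E.
have mB : measurable B by exact: mfk.
rewrite integral_indic// nuE; last exact: measurableI.
rewrite /density setIC integral_mkcondr.
apply: eq_integral => x _; rewrite patchE indicE.
by case: (x \in B); rewrite ?mul1e ?mul0e.
Qed.

End density.

Section density_on_line.
Context {R : realType}.
Notation RT := (measurableTypeR R).
Variables (nu : {measure set RT -> \bar R}) (g : R -> R).
Hypothesis g_ge0 : forall x, 0 <= g x.
Hypothesis mg : measurable_fun [set: RT] (g : RT -> R).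
Hypothesis nu_fin : forall x y, (nu `]x, y]%classic < +oo)%E.
Local Notation lam := (@lebesgue_measure R).

Lemma density_unique :
  (forall x y, x < y -> nu `]x, y]%classic = (\int[lam]_(z in `]x, y]) (g z)%:E)%E) ->
  forall A, measurable A -> nu A = density lam g A.
Proof.
move=> H A mA.
pose gk (k : nat) : set RT := `]- k%:R, k%:R]%classic.
pose dm := density_measure lam g_ge0 mg.
have -> : density lam g A = dm A by [].
apply: (@measure_unique _ R RT (@ocitv R : set (set RT)) gk _ _ _ _ nu dm) => //.
- exact: ocitvI.
- by move=> i; exact: is_ocitv.
- apply/seteqP; split => // x _; exists (Num.truncn `|x|).+1 => //.
  rewrite /gk /= in_itv/=; have := truncnS_gt `|x|.
  by rewrite ltr_norml => /andP[-> /ltW].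
- move=> _ [[x y] _ <-] /=.
  have [xy|yx] := ltP x y; first exact: H.
  by rewrite set_itv_ge ?bnd_simp -?leNgt// !measure0.
- by move=> k; exact: nu_fin.
Qed.

(** [density_itv] starts only at points where [c] is positive, so ]t, y] is reached as the
    increasing union of ]t + 1/(n+1), y], while the mass up to t is zero on both sides. *)
Lemma half_line_density_unique t :
  nu `]-oo, t]%classic = 0%E -> (forall x, x <= t -> g x = 0) ->
  (forall x y, t < x -> x < y ->
     nu `]x, y]%classic = (\int[lam]_(z in `]x, y]) (g z)%:E)%E) ->
  forall A, measurable A -> nu A = density lam g A.
Proof.
move=> nut gt H; apply: density_unique => x y xy.
pose dm := density_measure lam g_ge0 mg.
rewrite -[RHS]/(dm `]x, y]%classic).
have dmt : dm `]-oo, t]%classic = 0%E.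
  by apply: integral0_eq => z /=; rewrite in_itv/= => zt; rewrite gt.
have null (mm : {measure set RT -> \bar R}) a b : mm `]-oo, t]%classic = 0%E ->
    b <= t -> mm `]a, b]%classic = 0%E.
  move=> m0 bt; apply: (subset_measure0 _ _ _ m0) => // z /=.
  by rewrite !in_itv/= => /andP[_ /le_trans]; apply.
have [xt|tx] := leP x t; last exact: H.
have [yt|ty] := leP y t; first by rewrite !null.
have red (mm : {measure set RT -> \bar R}) : mm `]-oo, t]%classic = 0%E ->
    mm `]x, y]%classic = mm `]t, y]%classic.
  move=> m0.
  have -> : `]x, y]%classic = (`]t, y]%classic : set RT) `|` `]x, t]%classic.
    apply/seteqP; split => s /=; rewrite !in_itv/=.
      by move=> /andP[xs sy]; have [] := leP s t; [right; rewrite xs|left].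
    move=> [/andP[/(le_lt_trans xt) -> ->//]|/andP[-> /le_trans]]; apply.
    exact: ltW.
  by rewrite measureU0//; exact: null.
rewrite !red//.
have cv (mm : {measure set RT -> \bar R}) :
   mm (`]t + n.+1%:R^-1, y]%classic : set RT) @[n --> \oo] --> mm `]t, y]%classic.
  have -> : `]t, y]%classic = \bigcup_n (`]t + n.+1%:R^-1, y]%classic : set RT).
    apply/seteqP; split => s /=; rewrite ?in_itv/=.
      move=> /andP[ts sy]; exists (Num.truncn (s - t)^-1) => //=.
      rewrite in_itv/= sy andbT -ltrBrDl.
      by rewrite invf_plt ?posrE ?subr_gt0// truncnS_gt.
    move=> [n _ /=]; rewrite in_itv/= => /andP[ts ->]; rewrite andbT.
    by apply: lt_trans ts; rewrite ltrDl.
  apply: nondecreasing_cvg_mu => //; first exact: bigcup_measurable.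
  move=> n p np; apply/subsetPset => s /=; rewrite !in_itv/= => /andP[ns ->].
  rewrite andbT; apply: le_lt_trans ns.
  by rewrite lerD2l lef_pV2 ?posrE// ler_nat.
apply: (cvg_unique (@ereal_hausdorff R) (cv nu)).
rewrite (_ : (fun n => _) = (fun n => dm (`]t + n.+1%:R^-1, y]%classic : set RT))).
  exact: cv.
apply/funext => n.
have [yn|ny] := leP y (t + n.+1%:R^-1).
  by rewrite set_itv_ge ?bnd_simp -?leNgt// !measure0.
by apply: H => //; rewrite ltrDl.
Qed.

End density_on_line.

(** * Affine changes of variables and the Gamma integral *)

Section affine_change_of_variables.
Context {R : realType}.
Notation RT := (measurableTypeR R).
Local Notation lam := (@lebesgue_measure R).
Variables (r t : R).
Hypothesis r_gt0 : 0 < r.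
Let phi (x : RT) : RT := r * x + t.

Let measurable_phi : measurable_fun setT phi.
Proof.
by apply: measurable_funD => //; apply: measurable_funM => //; exact: measurable_cst.
Qed.

(** Multiplied by r, the image of [lam] gives half-open intervals their length, and this determines
    Lebesgue measure. *)
Lemma lebesgue_measure_affine (A : set RT) : measurable A ->
  lam A = (r%:E * pushforward lam phi A)%E.
Proof.
move=> mA.
have [pm pmE] : exists pm : {measure set RT -> \bar R},
    forall A, pm A = pushforward lam phi A.
  unshelve eexists (pushforward lam phi); first exact: measurable_phi.
  by [].
rewrite -pmE -[RHS]/(mscale (NngNum (ltW r_gt0)) pm A).
apply: lebesgue_measure_unique mA.
move=> _ [[a b] _ <-].
rewrite -[RHS]/(r%:E * pm `]a, b]%classic)%E pmE /pushforward.
have -> : phi @^-1` `]a, b]%classic = `](a - t) / r, (b - t) / r]%classic.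
  apply/seteqP; split => x /=; rewrite !in_itv/= /phi.
    by rewrite ltr_pdivrMr// ler_pdivlMr// -ltrBlDr lerBrDr mulrC.
  by rewrite ltr_pdivrMr// ler_pdivlMr// -ltrBlDr lerBrDr mulrC.
rewrite !lebesgue_measure_itv/= !lte_fin ltr_pM2r ?invr_gt0// ltrD2r.
case: ifP => _; last by rewrite mule0.
by rewrite -!EFinB -EFinM; congr EFin; field; rewrite gt_eqF.
Qed.

Lemma ge0_integral_affine (D : set RT) (f : RT -> \bar R) :
  measurable D -> measurable_fun D f -> (forall x, D x -> (0 <= f x)%E) ->
  (\int[lam]_(y in D) f y = r%:E * \int[lam]_(x in phi @^-1` D) f (phi x))%E.
Proof.
move=> mD mf f0.
have [pm pmE] : exists pm : {measure set RT -> \bar R},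
    forall A, pm A = pushforward lam phi A.
  unshelve eexists (pushforward lam phi); first exact: measurable_phi.
  by [].
rewrite -[in RHS](@ge0_integral_pushforward _ _ _ _ _ phi measurable_phi lam D f)//.
  rewrite (_ : (\int[pushforward lam phi]_(y in D) f y =
                \int[pm]_(y in D) f y)%E); last first.
    by apply: eq_measure_integral => A mA _; rewrite pmE.
  rewrite -(@ge0_integral_mscale _ _ _ pm D mD (NngNum (ltW r_gt0)) f)//.
  apply: eq_measure_integral => A mA _.
  by rewrite -[RHS]/(r%:E * pm A)%E pmE; exact: lebesgue_measure_affine.
by move=> y /[!inE] /f0.
Qed.

End affine_change_of_variables.

Section gamma_integral.
Context {R : realType}.
Notation RT := (measurableTypeR R).
Local Notation lam := (@lebesgue_measure R).
Implicit Types (p s x t : R).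

(** The exponent s may have any sign: positive values show where the Laplace transform becomes
    infinite. *)
Definition gamma_kernel p s x : R := x `^ (p - 1) * expR (s * x) * \1_`]0%R, +oo[ x.

Lemma gamma_kernel_ge0 p s x : 0 <= gamma_kernel p s x.
Proof. by rewrite !mulr_ge0 ?powR_ge0 ?expR_ge0. Qed.

Lemma measurable_gamma_kernel p s :
  measurable_fun setT (gamma_kernel p s : RT -> RT).
Proof.
apply: measurable_funM; last exact: measurable_indic.
by apply: measurable_funM; [exact: measurable_powR|exact: measurable_expRM].
Qed.

Let gammaI p s := (\int[lam]_x (gamma_kernel p s x)%:E)%E.

Lemma Gamma_funE p : Gamma_fun p = fine (gammaI p (-1)).
Proof.
rewrite /Gamma_fun Rintegral_mkcond /Rintegral; congr fine.
apply: eq_integral => x _; congr EFin.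
rewrite patchE /gamma_kernel indicE mulN1r.
by case: ifPn => _; rewrite ?mulr1 ?mulr0.
Qed.

(** Substitution y = l x. It normalizes the Gamma density and also transports finiteness from one
    rate to another. *)
Lemma gamma_scaling p l : 0 < l -> gammaI p (-1) = ((l `^ p)%:E * gammaI p (- l))%E.
Proof.
move=> l0.
have mE p' s : measurable_fun [set: RT] (fun x => (gamma_kernel p' s x)%:E).
  by apply/measurable_EFinP; exact: measurable_gamma_kernel.
rewrite /gammaI (@ge0_integral_affine _ l 0)//; last first.
  by move=> x _; rewrite lee_fin gamma_kernel_ge0.
rewrite preimage_setT.
have -> : (fun x => (gamma_kernel p (-1) (l * x + 0))%:E) =
    (fun x => (l `^ (p - 1))%:E * (gamma_kernel p (- l) x)%:E)%E.
  apply/funext => x; rewrite -EFinM addr0 /gamma_kernel; congr EFin.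
  rewrite !indicE !mem_setE/= !in_itv/= !andbT pmulr_rgt0//.
  have [x0|x0] := ltP 0 x; rewrite ?mulr0// powRM ?ltW//.
  by rewrite mulN1r mulNr !mulrA.
rewrite ge0_integralZl_EFin ?powR_ge0//; last first.
  by move=> x _; rewrite lee_fin gamma_kernel_ge0.
rewrite muleA -EFinM; congr ((_%:E) * _)%E.
have l_neq0 : l != 0 by rewrite gt_eqF.
have -> : l `^ p = l `^ 1 * l `^ (p - 1).
  by rewrite -powRD ?l_neq0 ?implybT//; congr (_ `^ _); ring.
by rewrite powRr1// ltW.
Qed.

Lemma gammaI_gt0 p : (0 < gammaI p (-1))%E.
Proof.
rewrite lt_neqAle integral_ge0 ?andbT; last first.
  by move=> x _; rewrite lee_fin gamma_kernel_ge0.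
apply/eqP => /esym I0.
have mk : measurable_fun (`]0%R, +oo[%classic : set RT)
    (fun x : RT => x `^ (p - 1) * expR (- x)).
  apply: measurable_funTS; apply: measurable_funM; first exact: measurable_powR.
  exact: measurableT_comp.
have : lam `]0%R, +oo[%classic = 0%E.
  apply: (@gt0_integral_eq0 _ _ _ lam _ (fun x => x `^ (p - 1) * expR (- x))) => //.
    move=> x /=; rewrite in_itv/= andbT => x0.
    by rewrite mulr_gt0 ?powR_gt0 ?expR_gt0.
  rewrite -[RHS]I0 integral_mkcond; apply: eq_integral => x _.
  rewrite patchE /gamma_kernel indicE mulN1r.
  by case: ifPn => _; rewrite ?mulr1 ?mulr0.
by rewrite lebesgue_measure_itv/= ltry.
Qed.

(** For x >= 1, p > 0 gives x^(p-1) >= 1/x, and e^(s x) >= s x, so the kernel is at least s on a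
    half-line. *)
Lemma gammaI_pinfty p s : 0 < p -> 0 < s -> gammaI p s = +oo%E.
Proof.
move=> p0 s0; apply/eqP; rewrite -leye_eq.
have -> : (+oo = \int[lam]_(x in `[1%R, +oo[) s%:E)%E.
  rewrite integral_cst//; transitivity (s%:E * +oo)%E.
    by rewrite gt0_muley// lte_fin.
  congr (_ * _)%E; apply: esym.
  by rewrite -[LHS]/(lam `[1%R, +oo[%classic) lebesgue_measure_itv/= ltry.
apply: (@le_trans _ _ (\int[lam]_(x in `[1%R, +oo[) (gamma_kernel p s x)%:E)%E).
  apply: ge0_le_integral => //.
  - by move=> x _; rewrite lee_fin ltW.
  - by apply/measurable_EFinP/measurable_funTS; exact: measurable_gamma_kernel.
  - move=> x /=; rewrite in_itv/= andbT => x1; rewrite lee_fin.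
    have x0 : 0 < x by rewrite (lt_le_trans _ x1).
    rewrite /gamma_kernel indicE mem_set/= ?in_itv/= ?x0// mulr1.
    have xV : x^-1 <= x `^ (p - 1).
      by rewrite -(powR_inv1 (ltW x0)); apply: ler_powR => //; lra.
    apply: (@le_trans _ _ (x^-1 * (s * x))).
      by rewrite mulrCA mulVf ?mulr1// gt_eqF.
    rewrite ler_pM// ?invr_ge0 ?mulr_ge0 ?(ltW x0) ?(ltW s0)//.
    by apply: le_trans (expR_ge1Dx _); rewrite lerDr.
apply: ge0_subset_integral => //.
- by apply/measurable_EFinP; exact: measurable_gamma_kernel.
- by move=> x _; rewrite lee_fin gamma_kernel_ge0.
Qed.

Lemma gamma_pdfE p s x : gamma_pdf p s x = (- s) `^ p / Gamma_fun p * gamma_kernel p s x.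
Proof. by rewrite /gamma_pdf /gamma_kernel; ring. Qed.

(** Finiteness matters because [fine] sends an infinite integral to 0. It is obtained later from the
    Laplace transform at [th1]. *)
Lemma Gamma_fun_gt0 p : (gammaI p (-1) < +oo)%E -> 0 < Gamma_fun p.
Proof. by move=> I; rewrite Gamma_funE fine_gt0// gammaI_gt0. Qed.

Lemma gamma_pdf_ge0 p s x : (gammaI p (-1) < +oo)%E -> 0 <= gamma_pdf p s x.
Proof.
move=> /Gamma_fun_gt0/ltW I.
by rewrite gamma_pdfE mulr_ge0 ?gamma_kernel_ge0// divr_ge0// powR_ge0.
Qed.

Lemma measurable_gamma_pdf p s : measurable_fun setT (gamma_pdf p s : RT -> RT).
Proof.
rewrite (_ : gamma_pdf p s = fun x => (- s) `^ p / Gamma_fun p * gamma_kernel p s x).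
  by apply: measurable_funM => //; exact: measurable_gamma_kernel.
by apply/funext => x; exact: gamma_pdfE.
Qed.

Lemma integral_gamma_pdf p s : (gammaI p (-1) < +oo)%E -> s < 0 ->
  (\int[lam]_x (gamma_pdf p s x)%:E = 1)%E.
Proof.
move=> Ioo s0; have I0 := gammaI_gt0 p.
have G0 := Gamma_fun_gt0 Ioo.
under eq_integral do rewrite gamma_pdfE EFinM.
rewrite ge0_integralZl_EFin//; last 3 first.
- by move=> x _; rewrite lee_fin gamma_kernel_ge0.
- by apply/measurable_EFinP; exact: measurable_gamma_kernel.
- by rewrite divr_ge0 ?powR_ge0 ?ltW.
have s0' : 0 < - s by rewrite oppr_gt0.
have S := gamma_scaling p s0'; rewrite opprK in S.
rewrite -/(gammaI p s) mulrC EFinM -muleA -S Gamma_funE.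
have If : gammaI p (-1) \is a fin_num by rewrite ge0_fin_numE// ltW.
by rewrite -[X in (_ * X)%E](fineK If) -EFinM mulVf// gt_eqF// fine_gt0// I0.
Qed.

End gamma_integral.

(** * Tilting a measure with a density and translating a family *)

Section families.
Context {R : realType}.
Notation RT := (measurableTypeR R).
Local Notation lam := (@lebesgue_measure R).
Implicit Types (nu : {measure set RT -> \bar R}) (t : R).

(** Once the tilted density is K times a probability density, K has to be the Laplace transform; no
    further integral is computed. *)
Lemma tilt_of_density nu (h f : R -> R) th K :
  (forall x, 0 <= h x) -> measurable_fun setT (h : RT -> RT) ->
  (forall A, measurable A -> nu A = density lam h A) ->
  (forall x, 0 <= f x) -> measurable_fun setT (f : RT -> RT) ->
  (\int[lam]_x (f x)%:E = 1)%E -> 0 < K ->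
  (forall x, expR (th * x) * h x = K * f x) ->
  laplace nu th = K%:E /\
  forall A, measurable A -> tilt nu th A = (\int[lam]_(x in A) (f x)%:E)%E.
Proof.
move=> h0 mh nuE f0 mf f1 K0 hf.
have LK : laplace nu th = K%:E.
  rewrite /laplace (@ge0_integral_density _ RT R lam h h0 mh nu _ _ nuE)//; last first.
    by apply/measurable_EFinP; exact: measurable_expRM.
  under eq_integral do rewrite -EFinM hf EFinM.
  rewrite ge0_integralZl_EFin ?f1 ?mule1 ?ltW//.
    by move=> x _; rewrite lee_fin.
  exact/measurable_EFinP.
split => // A mA; rewrite /tilt /cumulant LK.
rewrite (@ge0_integral_density _ RT R lam h h0 mh nu _ _ nuE)//; last first.
  apply/measurable_EFinP/measurable_funTS; apply: measurableT_comp => //.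
  by apply: measurable_funB => //; apply: measurable_funM => //; exact: measurable_cst.
apply: eq_integral => x _; rewrite -EFinM expRD expRN /= lnK ?posrE//.
by rewrite mulrAC hf mulrAC divff ?mul1r// gt_eqF.
Qed.

Lemma probability_pushforward (P : probability RT R) (f : RT -> RT) :
  measurable_fun setT f ->
  exists Q : probability RT R, forall A, Q A = pushforward P f A.
Proof.
move=> mf; pose X : {mfun RT >-> RT} := HB.pack f (isMeasurableFun.Build _ _ _ _ _ mf).
by exists (distribution P X).
Qed.

(** Eliminates the untranslated probability of [translate_family]: it is recovered from [Q] as the
    image under translation by -t. *)
Lemma translate_familyE t (I : set R) (law : R -> set RT -> \bar R) :
  translate_family t
    [set P : probability RT R | exists2 s, I s & same_law P (law s)] =
  [set Q : probability RT R | exists2 s, I s &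
    same_law Q (fun A => law s ((fun x : RT => x + t : RT) @^-1` A))].
Proof.
have mD u : measurable_fun [set: RT] (fun x : RT => x + u : RT).
  exact: measurable_funD.
have mpre u (A : set RT) : measurable A ->
    measurable ((fun x : RT => x + u : RT) @^-1` A).
  by move=> mA; rewrite -[X in measurable X]setTI; exact: mD.
apply/seteqP; split => [Q [P [s Is PE] QE]|Q [s Is QE]].
  by exists s => // A mA; rewrite QE// /pushforward PE//; exact: mpre.
have [P PE] := probability_pushforward Q (mD (- t)).
exists P.
  exists s => // A mA; rewrite PE /pushforward QE; last exact: mpre.
  rewrite -comp_preimage; congr (law s _).
  by apply/seteqP; split => x /=; rewrite addrK.
move=> A mA; rewrite /pushforward PE /pushforward -comp_preimage; congr (Q _).
by apply/seteqP; split => x /=; rewrite subrK.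
Qed.

End families.

(** * Identification of the families *)

Section identification.
Context {R : realType}.
Notation RT := (measurableTypeR R).
Local Notation lam := (@lebesgue_measure R).
Implicit Types (nu : {measure set RT -> \bar R}) (t : R).

Lemma measurable_gaussian (C b s : R) : measurable_fun [set: RT]
  (fun x : RT => C * expR (b * x - x ^+ 2 / (s ^+ 2 *+ 2)) : RT).
Proof.
apply: measurable_funM => //; apply: measurableT_comp => //.
apply: measurable_funB; first by apply: measurable_funM => //; exact: measurable_cst.
apply: measurable_funM; last exact: measurable_cst.
exact: (@measurable_funX _ RT R setT (fun x => x) 2%N).
Qed.

(** Completing the square, tilting by [th] gives the Gaussian law of parameter [th + b]. The
    transform is finite everywhere, so all real parameters occur. *)
Lemma exp_family_gaussian nu (C b s : R) : 0 < C -> 0 < s ->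
  (forall A, measurable A ->
    nu A = density lam (fun x => C * expR (b * x - x ^+ 2 / (s ^+ 2 *+ 2))) A) ->
  exp_family nu = translate_family 0 (gaussian_family s).
Proof.
move=> C0 s0 nuE.
pose h x := C * expR (b * x - x ^+ 2 / (s ^+ 2 *+ 2)).
have s_neq0 : s != 0 by rewrite gt_eqF.
have s2 : 0 < s ^+ 2 *+ 2 by rewrite pmulrn_lgt0// exprn_gt0.
pose f th := normal_pdf ((th + b) * s ^+ 2) s.
(* The exponential is left over from completing the square; [normal_peak] undoes the normalization
   of [normal_pdf]. *)
pose K th := C * expR (((th + b) * s ^+ 2) ^+ 2 / (s ^+ 2 *+ 2)) / normal_peak s.
have K0 th : 0 < K th by rewrite divr_gt0 ?normal_peak_gt0// mulr_gt0// expR_gt0.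
have hf th x : expR (th * x) * h x = K th * f th x.
  rewrite /f normal_pdfE// /K [RHS]mulrA divfK ?gt_eqF ?normal_peak_gt0//.
  rewrite /h mulrCA -!mulrA -!expRD; congr (_ * expR _).
  by rewrite -mulr_natr; field.
have h0 x : 0 <= h x by rewrite mulr_ge0 ?expR_ge0 ?ltW.
have mh : measurable_fun setT (h : RT -> RT) by exact: measurable_gaussian.
have tiltE th : laplace nu th = (K th)%:E /\
    forall A, measurable A -> tilt nu th A = normal_prob ((th + b) * s ^+ 2) s A.
  apply: (tilt_of_density h0 mh nuE) => //.
  - by move=> x; exact: normal_pdf_ge0.
  - exact: measurable_normal_pdf.
  - exact: integral_normal_pdf.
have int th : laplace_interior nu th.
  rewrite /laplace_interior (_ : [set _ | _] = setT) ?interiorT//.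
  by apply/seteqP; split => // x _ /=; rewrite (tiltE x).1 ltry.
have -> : gaussian_family s = [set P : probability RT R |
    exists2 th, setT th & same_law P (normal_prob (th * s ^+ 2) s)].
  by apply/seteqP; split => P [th]; [exists th|move=> _; exists th].
rewrite translate_familyE.
have pre0 (A : set RT) : (fun x : RT => x + 0 : RT) @^-1` A = A.
  by apply/seteqP; split => x /=; rewrite addr0.
apply/seteqP; split => [P [th _ PE]|P [th _ PE]].
  by exists (th + b) => // A mA; rewrite pre0 PE// (tiltE th).2.
exists (th - b) => // A mA; rewrite PE// pre0 (tiltE _).2//.
by rewrite subrK.
Qed.

(** Tilting by [th] gives the translated Gamma law of parameter [th - th0], so the negative
    parameters match exactly if the interior is ]-oo, th0[. *)
Lemma exp_family_gamma nu (C th0 th1 p t : R) : 0 < C -> 0 < p -> th1 < th0 ->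
  (laplace nu th1 < +oo)%E ->
  (forall A, measurable A ->
    nu A = density lam (fun x => C * gamma_kernel p (- th0) (x - t)) A) ->
  exp_family nu = translate_family t (gamma_family p).
Proof.
move=> C0 p0 th10 L1 nuE.
pose h x := C * gamma_kernel p (- th0) (x - t).
have h0 x : 0 <= h x by rewrite mulr_ge0 ?gamma_kernel_ge0 ?ltW.
have msub : measurable_fun [set: RT] (fun x : RT => x - t : RT) by exact: measurable_funB.
have mh : measurable_fun setT (h : RT -> RT).
  apply: measurable_funM => //.
  exact: (measurableT_comp (measurable_gamma_kernel p (- th0)) msub).
have kernelE th x : expR (th * x) * h x =
    C * expR ((th - th0) * t + th0 * t) * gamma_kernel p (th - th0) (x - t).
  rewrite /h /gamma_kernel.
  have -> : (th - th0) * (x - t) = (- th0 * (x - t) + th * x) - th * t by ring.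
  rewrite !expRD expRN.
  have -> : (th - th0) * t = th * t - th0 * t by ring.
  rewrite expRD expRN; field.
  by rewrite !gt_eqF ?expR_gt0.
have shift (A : set RT) (f : RT -> \bar R) : measurable A -> measurable_fun A f ->
    (forall x, A x -> (0 <= f x)%E) ->
    (\int[lam]_(x in A) f x =
     \int[lam]_(x in (fun x : RT => (x + t : RT)%R) @^-1` A) f (x + t)%R)%E.
  move=> mA mf f0; rewrite (ge0_integral_affine t (@ltr01 R) mA mf f0) mul1e.
  have -> : (fun x => 1 * x + t) = (fun x : RT => x + t : RT).
    by apply/funext => x; rewrite mul1r.
  by apply: eq_integral => x _; rewrite mul1r.
have mker th : measurable_fun [set: RT]
    (fun x : RT => gamma_kernel p (th - th0) (x - t)).
  exact: (measurableT_comp (measurable_gamma_kernel p (th - th0)) msub).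
have LE th : laplace nu th = ((C * expR ((th - th0) * t + th0 * t))%:E *
    \int[lam]_x (gamma_kernel p (th - th0) x)%:E)%E.
  rewrite /laplace (@ge0_integral_density _ RT R lam h h0 mh nu _ _ nuE)//; last first.
    by apply/measurable_EFinP; exact: measurable_expRM.
  under eq_integral do rewrite -EFinM kernelE EFinM.
  rewrite ge0_integralZl_EFin//; last 3 first.
  - by move=> x _; rewrite lee_fin gamma_kernel_ge0.
  - by apply/measurable_EFinP; exact: mker.
  - by rewrite mulr_ge0 ?expR_ge0 ?ltW.
  rewrite [in LHS]shift//; last 2 first.
  - by apply/measurable_EFinP; exact: mker.
  - by move=> x _; rewrite lee_fin gamma_kernel_ge0.
  rewrite preimage_setT; congr (_ * _)%E.
  by apply: eq_integral => x _; rewrite addrK.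
have Ce th : 0 < C * expR ((th - th0) * t + th0 * t) by rewrite mulr_gt0 ?expR_gt0.
(* Up to positive finite factors this integral is the Laplace transform at [th1], by scaling with l
   = th0 - th1. *)
have Ioo : (\int[lam]_x (gamma_kernel p (-1) x)%:E < +oo)%E.
  have l0 : 0 < th0 - th1 by rewrite subr_gt0.
  rewrite (gamma_scaling p l0) opprB lte_mul_pinfty ?lee_fin ?powR_ge0//.
  move: L1; rewrite LE => L1; rewrite ltNge leye_eq; apply/negP => /eqP I1.
  by move: L1; rewrite I1 gt0_muley ?ltxx// lte_fin.
have G0 := Gamma_fun_gt0 Ioo.
pose f th x := gamma_pdf p (th - th0) (x - t).
have tiltE th : th < th0 -> (laplace nu th < +oo)%E /\
    forall A, measurable A -> tilt nu th A =
      gamma_prob p (th - th0) ((fun x : RT => (x + t : RT)) @^-1` A).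
  move=> thlt; have s0 : th - th0 < 0 by rewrite subr_lt0.
  have f0 x : 0 <= f th x by exact: gamma_pdf_ge0.
  have mf : measurable_fun setT (f th : RT -> RT).
    exact: (measurableT_comp (measurable_gamma_pdf p (th - th0)) msub).
  have fE A : measurable A -> (\int[lam]_(x in A) (f th x)%:E)%E =
      gamma_prob p (th - th0) ((fun x : RT => (x + t : RT)) @^-1` A).
    move=> mA; rewrite [in LHS]shift//; last 2 first.
    - by apply/measurable_EFinP; exact: measurable_funTS.
    - by move=> x _; rewrite lee_fin.
    by apply: eq_integral => x _; rewrite /f addrK.
  have np : 0 < (- (th - th0)) `^ p / Gamma_fun p.
    by rewrite divr_gt0// powR_gt0// oppr_gt0.
  have [|||LK tE] := @tilt_of_density _ nu h (f th) th
      (C * expR ((th - th0) * t + th0 * t) / ((- (th - th0)) `^ p / Gamma_fun p))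
      h0 mh nuE f0 mf.
  - by rewrite fE// preimage_setT; exact: integral_gamma_pdf.
  - by rewrite divr_gt0.
  - by move=> x; rewrite kernelE /f gamma_pdfE [RHS]mulrA divfK// gt_eqF.
  by split => [|A mA]; [rewrite LK ltry|rewrite tE// fE].
(* A neighbourhood of a point th >= th0 contains a parameter strictly above [th0], where the
   transform is infinite. *)
have intE th : laplace_interior nu th <-> th < th0.
  split => [/nbhs_ballP[e /= e0 H]|th_lt].
    rewrite ltNge; apply/negP => th0le.
    have : ball th e (th + e / 2).
      by rewrite /ball/= opprD addNKr normrN gtr0_norm; lra.
    move/H => /=; rewrite LE gammaI_pinfty//; last by rewrite subr_gt0; lra.
    by rewrite gt0_muley ?ltxx// lte_fin.
  apply: (@filterS _ (nbhs th) _ [set s | s < th0]); last exact: lt_nbhsl.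
  by move=> u /= /tiltE[].
rewrite translate_familyE; apply/seteqP; split => [P [th /intE thlt PE]|P [s s0 PE]].
  exists (th - th0); first by rewrite /= subr_lt0.
  by move=> A mA; rewrite PE// (tiltE _ thlt).2.
have slt : s + th0 < th0 by rewrite gtrDr.
exists (s + th0); first exact/intE.
by move=> A mA; rewrite PE// (tiltE _ slt).2// addrK.
Qed.

End identification.

(** * Choice of two parameters and conclusion *)

Lemma ereal_real_between (R : realType) (a b : \bar R) : (a < b)%E ->
  exists r : R, (a < r%:E)%E /\ (r%:E < b)%E.
Proof.
case: a b => [a| |] [b| |] //= ab.
- exists ((a + b) / 2); move: ab; rewrite !lte_fin => ab.
  by split; lra.
- by exists (a + 1); rewrite lte_fin ltrDl ltry.
- by exists (b - 1); rewrite ltNyr lte_fin gtrBl.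
- by exists 0; rewrite ltNyr ltry.
Qed.

Lemma interior_two_points (R : realType) (S : set R) th1 : interior S th1 ->
  exists2 th2, th1 != th2 & interior S th2.
Proof.
move=> H; have : nbhs th1 (interior S).
  by apply: open_nbhs_nbhs; split => //; exact: open_interior.
move=> /nbhs_ballP[e /= e0 He]; exists (th1 + e / 2).
  by rewrite lt_eqF// ltrDl divr_gt0.
by apply: He; rewrite /ball/= opprD addNKr normrN gtr0_norm; lra.
Qed.

Theorem theorem2 (R : realType)
    (nu : {measure set (measurableTypeR R) -> \bar R})
    (alpha beta : \bar R)
    (nu_not_point : ~ concentrated_on_a_point nu)
    (alpha_lt_beta : (alpha < beta)%E)
    (interior_eq : laplace_interior nu =
       [set theta : R | (alpha < theta%:E)%E /\ (theta%:E < beta)%E])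
    (mu : {measure set (measurableTypeR R) -> \bar R})
    (mu_supp : mu (~` [set u : measurableTypeR R |
                       (alpha < (u : R)%:E)%E /\ ((u : R)%:E < beta)%E]) = 0%E)
    (c : R -> R)
    (cdf_eq : forall x theta : R,
       (alpha < theta%:E)%E -> (theta%:E < beta)%E ->
       tilt nu theta `]-oo, x] =
       ((c x)%:E * \int[mu]_(u in [set u : measurableTypeR R |
                      (theta < u)%R /\ ((u : R)%:E < beta)%E])
                      (expR (u * x))%:E)%E) :
  exists t : R,
    (exists2 sigma : R, 0 < sigma &
       exp_family nu = translate_family t (gaussian_family sigma)) \/
    (exists2 p : R, 0 < p &
       exp_family nu = translate_family t (gamma_family p)).
Proof.
have [th1 th1ab] := ereal_real_between alpha_lt_beta.
have H1 : laplace_interior nu th1 by rewrite interior_eq.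
have [th2 th12 H2] := interior_two_points H1.
have int0 : exists th, laplace_interior nu th by exists th1.
have intb th : laplace_interior nu th -> (th%:E < beta)%E.
  by rewrite interior_eq => -[].
have cdf x th : laplace_interior nu th -> tilt nu th `]-oo, x] =
    ((c x)%:E * \int[mu]_(u in [set u : measurableTypeR R |
      (th < u)%R /\ ((u : R)%:E < beta)%E]) (expR (u * x))%:E)%E.
  by rewrite interior_eq => -[? ?]; exact: cdf_eq.
have [k1 [N1 [N10 W1]]] := weighted_exponential nu_not_point intb int0 cdf H1.
have [k2 [N2 [N20 W2]]] := weighted_exponential nu_not_point intb int0 cdf H2.
have c0 := weight_ge0 nu_not_point int0 cdf.
have cE := weight_eq0 nu_not_point int0 cdf.
have cn0 : exists x, 0 < c x.
  have [x x0] := exists_left_ray_neq0 nu_not_point.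
  by exists x; rewrite lt_neqAle c0 andbT eq_sym cE.
have nufin := nu_itv_lty H1.
have [cpos|[t ct]] := c_support th12 H1 H2 W1 W2 c0 cE cn0.
  have [C [A [b [C0 A0 sE cEq]]]] := full_support th12 H1 H2 N10 W1 W2 cpos.
  (* No translation is needed: the mean is absorbed by theta. *)
  exists 0; left; pose s := Num.sqrt (A / N1).
  have s0 : 0 < s by rewrite sqrtr_gt0 divr_gt0.
  (* The quadratic term N1 x^2 / (2A) in the exponent of [c] has to be x^2 / (2 s^2). *)
  have sqs : s ^+ 2 = A / N1 by rewrite sqr_sqrtr// ltW// divr_gt0.
  exists s => //; apply: (@exp_family_gaussian _ nu (C / A) b) => //.
    exact: divr_gt0.
  have g0 x : 0 <= C / A * expR (b * x - x ^+ 2 / (s ^+ 2 *+ 2)).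
    by rewrite mulr_ge0 ?expR_ge0// divr_ge0// ltW.
  apply: (density_unique g0) => // [|x y xy].
    exact: (measurable_gaussian (C / A) b s).
  rewrite (density_itv th12 H1 H2 W1 W2 c0 cE (ltW xy))//.
  apply: eq_integral => z _; congr EFin; rewrite sE cEq mulrAC.
  congr (_ * expR (_ - _)); rewrite sqs -mulr_natr; field.
  by rewrite !gt_eqF.
have [C [B [th0 [p [[C0 B0 p0 th10] sE cEq]]]]] :=
  half_line_support th12 H1 H2 N10 W1 W2 c0 cE ct.
exists t; right; exists p => //.
(* Dividing [c] by B (x - t) lowers the power of x - t to p - 1; recentering e^(-th0 x) at t
   releases the factor e^(-th0 t). *)
have K0 : 0 < C / B * expR (- (th0 * t)) by rewrite mulr_gt0 ?divr_gt0 ?expR_gt0.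
apply: (exp_family_gamma K0 p0 th10); first exact: interior_laplace.
have g0 x : 0 <= C / B * expR (- (th0 * t)) * gamma_kernel p (- th0) (x - t).
  by rewrite mulr_ge0 ?gamma_kernel_ge0// ltW.
apply: (@half_line_density_unique _ nu _ g0 _ nufin t) => [||x xt|x y tx xy].
- apply: measurable_funM => //.
  have ms : measurable_fun [set: measurableTypeR R]
    (fun x : measurableTypeR R => x - t : measurableTypeR R) by exact: measurable_funB.
  exact: (measurableT_comp (measurable_gamma_kernel p (- th0)) ms).
- by apply/eqP; rewrite -cE eq_le c0 andbT leNgt ct ltxx.
- rewrite /gamma_kernel indicE memNset ?mulr0//= in_itv/= andbT subr_gt0.
  by apply/negP; rewrite -leNgt.
rewrite (density_itv th12 H1 H2 W1 W2 c0 cE (ltW xy)); last by rewrite ct.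
apply: eq_integral => z; rewrite inE/= in_itv/= => /andP[xz _]; congr EFin.
have zt : 0 < z - t by rewrite subr_gt0 (lt_trans tx).
rewrite sE cEq; last by rewrite -subr_gt0.
rewrite /gamma_kernel indicE mem_set/= ?in_itv/= ?zt// mulr1 /powR gt_eqF//.
have -> : (p - 1) * ln (z - t) = p * ln (z - t) - ln (z - t) by ring.
have -> : - th0 * (z - t) = th0 * t - th0 * z by ring.
rewrite !expRD !expRN lnK ?posrE//; field.
by rewrite !gt_eqF ?expR_gt0.
Qed.
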